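(* Let $(R,\mathfrak{m})$ be a Noetherian local ring or a standard graded algebra over a field with irrelevant ideal $\mathfrak{m}$. Suppose that $C,L\subseteq R$ are complete intersection ideals with $C\subseteq\mathfrak{m}L$ and that $f\in R$ is regular on $R$ and on $R/C$ (with $C$, $L$, $f$ all homogeneous in the graded case). Set $I=C+fL$. Then the minimal free resolution of $R/I$ over $R$ has the structure of a strictly commutative dg algebra.
   Context: A complete intersection ideal is an ideal generated by a regular sequence (homogeneous in the graded case). An element is regular on a module if it is a nonzerodivisor on it. A dg $R$-algebra is a graded $R$-algebra $A=\bigoplus_{i\ge0}A_i$ with $A_0=R$ (associative, unital) with a differential of degree $-1$ satisfying $\partial(ab)=\partial(a)b+(-1)^{|a|}a\partial(b)$; it is strictly commutative if $ab=(-1)^{|a||b|}ba$ for all homogeneous $a,b$ and $a^2=0$ for all homogeneous $a$ of odd degree. A free resolution has the structure of a dg algebra if there is a multiplication on it making it, with its given differential, a dg $R$-algebra. (In the section containing this result, the paper writes ''dg algebra'' for ''strictly commutative dg algebra''.) *)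

(* Defs.v *)
From HB Require Import structures.
From mathcomp Require Import all_boot all_order all_algebra.
From mathcomp Require Import boolp classical_sets.

Set Implicit Arguments.
Unset Strict Implicit.
Unset Printing Implicit Defensive.

Import GRing.Theory.
Local Open Scope classical_set_scope.
Local Open Scope ring_scope.

Section Ideals.
Variable R : comNzRingType.
Implicit Types (I J m : set R) (s : seq R) (x : R).

(* Unlike [idealr_closed], this allows the unit ideal. *)
Definition ideal I : Prop :=
  I 0 /\ (forall a u v, I u -> I v -> I (a * u + v)).

Definition ideal_gen s : set R :=
  [set x | exists c : 'I_(size s) -> R, x = \sum_i c i * s`_i].

Definition ideal_mul I J : set R :=
  [set x | exists (n : nat) (a b : 'I_n -> R),
     [/\ forall i, I (a i), forall i, J (b i) & x = \sum_i a i * b i]].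

(* C + f L *)
Definition ideal_add_scale (C : set R) (f : R) (L : set R) : set R :=
  [set x | exists c l : R, [/\ C c, L l & x = c + f * l]].

Definition noetherian : Prop :=
  forall I, ideal I -> exists s, I = ideal_gen s.

Definition maximal_ideal m : Prop :=
  [/\ ideal m, ~ m 1 & forall J, ideal J -> m `<=` J -> ~ J 1 -> J = m].

(* (R, m) is local: m is the unique maximal ideal. *)
Definition local_ring m : Prop :=
  maximal_ideal m /\ forall n, maximal_ideal n -> n = m.

(* x is a nonzerodivisor on the module R/J, read off on representatives. *)
Definition regular_mod J x : Prop := forall a, J (x * a) -> J a.

(* The empty sequence is regular, so the zero ideal is a complete
   intersection; the unit ideal is not. *)
Definition regular_sequence s : Prop :=
  (forall i, (i < size s)%N -> regular_mod (ideal_gen (take i s)) s`_i)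
  /\ ~ ideal_gen s 1.

Definition complete_intersection I : Prop :=
  exists s, regular_sequence s /\ I = ideal_gen s.

End Ideals.

Section Resolutions.
Variable R : comNzRingType.

(* A complex of finite free modules ... -> F_2 -> F_1 -> F_0 with F_0 = R,
   written in bases: elements of F_n are row vectors, and the differential
   F_(n+1) -> F_n is v |-> v *m diff n.  Only the ranks in positive degree
   are data. *)
Record free_complex := FreeComplex {
  pos_rank : nat -> nat;
  rank := fun n => if n is n'.+1 then pos_rank n' else 1%N;
  diff : forall n, 'M[R]_(rank n.+1, rank n)
}.

Implicit Types (F : free_complex) (I m : set R).

(* F is a free resolution of R/I, with augmentation the projection
   F_0 = R -> R/I. *)
Definition resolution F I : Prop :=
  (forall a : R, I a <->
     exists v : 'rV[R]_(rank F 1), v *m diff F 0 = a%:M :> 'rV[R]_1) /\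
  (forall n (v : 'rV[R]_(rank F n.+1)), v *m diff F n = 0 <->
     exists w : 'rV[R]_(rank F n.+2), v = w *m diff F n.+1).

Definition minimal m F : Prop := forall n i j, m (diff F n i j).

Definition minimal_free_resolution m F I : Prop :=
  resolution F I /\ minimal m F.

(* The differential on all of F, zero on F_0. *)
Definition bd F n : 'rV[R]_(rank F n) -> 'rV[R]_(rank F n.-1) :=
  match n return 'rV[R]_(rank F n) -> 'rV[R]_(rank F n.-1) with
  | 0 => fun _ => 0
  | n'.+1 => fun x => x *m diff F n'
  end.

(* [mu i j n x y] is the component in degree n of the product of x in F_i and
   y in F_j.  It vanishes for n <> i + j; keeping n separate avoids casts
   between F_(i + (j + k)) and F_((i + j) + k). *)
Definition product F : Type :=
  forall i j n : nat,
    'rV[R]_(rank F i) -> 'rV[R]_(rank F j) -> 'rV[R]_(rank F n).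

Record dg_algebra F (mu : product F) : Prop := DGAlgebra {
  mu_graded : forall i j n x y, n != (i + j)%N -> mu i j n x y = 0;
  mu_linear_l : forall i j n y, linear (fun x => mu i j n x y);
  mu_linear_r : forall i j n x, linear (mu i j n x);
  mu_assoc : forall i j k p q n x y z,
    p = (i + j)%N -> q = (j + k)%N -> n = (i + j + k)%N ->
    mu p k n (mu i j p x y) z = mu i q n x (mu j k q y z);
  mu_unit_l : forall i x, mu 0 i i (1%:M : 'rV[R]_1) x = x;
  mu_unit_r : forall i x, mu i 0 i x (1%:M : 'rV[R]_1) = x;
  (* If i = 0 or j = 0 the corresponding summand is zero, since bd is zero
     on F_0. *)
  mu_leibniz : forall i j n x y, n = (i + j)%N ->
    bd (mu i j n x y) =
      mu i.-1 j n.-1 (bd x) y + (-1) ^+ i *: mu i j.-1 n.-1 x (bd y)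
}.

Definition strictly_commutative F (mu : product F) : Prop :=
  (forall i j n x y, n = (i + j)%N ->
     mu i j n x y = (-1) ^+ (i * j) *: mu j i n y x) /\
  (forall i n x, odd i -> n = (i + i)%N -> mu i i n x x = 0).

Definition has_strict_cdga_structure F : Prop :=
  exists mu : product F, dg_algebra mu /\ strictly_commutative mu.

End Resolutions.

Section Graded.
Variables (k : fieldType) (R : comAlgType k).
Implicit Type G : nat -> set R.

Definition subspace (V : set R) : Prop :=
  V 0 /\ (forall (a : k) u v, V u -> V v -> V (a *: u + v)).

Definition subalgebra (S : set R) : Prop :=
  [/\ subspace S, S 1 & forall u v, S u -> S v -> S (u * v)].

(* R is the direct sum of the subspaces G n, which form a grading with
   G 0 = k; moreover G 1 is finite-dimensional and generates R. *)
Record standard_graded G : Prop := StandardGraded {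
  sg_subspace : forall n, subspace (G n);
  sg_mul : forall i j x y, G i x -> G j y -> G (i + j)%N (x * y);
  sg_span : forall x, exists (n : nat) (c : nat -> R),
    (forall i, G i (c i)) /\ x = \sum_(i < n) c i;
  sg_direct : forall (n : nat) (c : nat -> R), (forall i, G i (c i)) ->
    \sum_(i < n) c i = 0 -> forall i, (i < n)%N -> c i = 0;
  sg_zero : forall x, G 0%N x <-> exists a : k, x = a%:A;
  sg_finite : exists s : seq R, forall x, G 1%N x <->
    exists c : 'I_(size s) -> k, x = \sum_i c i *: s`_i;
  sg_generated : forall S, subalgebra S -> G 1%N `<=` S -> S = setT
}.

Definition irrelevant_ideal G : set R :=
  [set x | exists (n : nat) (c : nat -> R),
     (forall i, G i.+1 (c i)) /\ x = \sum_(i < n) c i].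

Definition homogeneous G (x : R) : Prop := exists n, G n x.

Definition homogeneous_complete_intersection G (I : set R) : Prop :=
  exists s, [/\ regular_sequence s, forall x, x \in s -> homogeneous G x
              & I = ideal_gen s].

(* The grading extended by zero to negative degrees. *)
Definition gradeZ G (z : int) : set R :=
  if z is Posz n then G n else [set 0].

(* The basis elements of F carry internal degrees for which the differential
   is homogeneous of degree 0, the generator of F_0 = R having degree 0. *)
Definition graded_complex G (F : free_complex R) : Prop :=
  exists e : forall n, 'I_(rank F n) -> int,
    (forall i, e 0%N i = 0) /\
    (forall n i j, gradeZ G (e n.+1 i - e n j) (diff F n i j)).

Definition minimal_graded_free_resolution G (F : free_complex R) (I : set R) :
    Prop :=
  minimal_free_resolution (irrelevant_ideal G) F I /\ graded_complex G F.

End Graded.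

(* Main.v *)
Require Import Defs.
From HB Require Import structures.
From mathcomp Require Import all_boot all_order all_algebra.
From mathcomp Require Import perm boolp classical_sets.
(* Write C = (c), L = (l), with Koszul algebras K(c) and K(l). Since C is
   contained in mL, there is a morphism phi : K(c) -> K(l) of dg algebras with
   entries in m in positive degree. Let E = K(c)<t> with dt = f. The fibre
   product T of E and K(l) over K(l)/f K(l) is a strictly commutative dg
   algebra; its elements are (k + t x, phi k + f y) with k, x in K(c) and y in
   K(l). It contains the dg subalgebra F with F_0 = R, F_1 consisting of the
   elements of T_1 whose differential lies in R, and F_n = T_n for n >= 2,
   which is a minimal free resolution of R/(C + fL). Minimal resolutions being
   unique up to isomorphism, the product transports to the given one. *)

Set Implicit Arguments.
Unset Strict Implicit.
Unset Printing Implicit Defensive.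

Import GRing.Theory.
Local Open Scope classical_set_scope.
Local Open Scope ring_scope.

(** Since f is regular modulo C and C lies in L, the quotient of C + fR by C + fL is a copy of R/L,
    so R/(C + fL) is an extension of R/(C + fR), resolved by E, by R/L, resolved by K(l). In the
    coordinates (u, y) with u in E and y in K(l), T is the corresponding extension of complexes: the
    differential of K(l) is corrected by phi applied to the coefficient of t in u. Thus T already
    resolves R/(C + fL), through (r, y) |-> r + f y in degree 0, but not minimally: T_0 has rank 2,
    and dt = (f, -1) has a unit entry. Passing to F removes exactly this contractible pair, and as F
    is a subalgebra and not a quotient, the product simply restricts.

    The obstacle is associativity: such an extension of complexes does not come with an associative
    product. Realising T inside E x K(l) settles this, because every identity holds in the two
    factors, and f acts injectively on the free module K(l), so that y can be recovered from phi k +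
    f y. *)

(* cj is the sign involution x |-> (-1)^|x| x, extended additively; it lets the
   Leibniz rule and graded commutativity be stated for arbitrary elements. *)
Record cdga (R : comNzRingType) := Cdga {
  car :> lmodType R;
  mul : car -> car -> car;
  one : car;
  cj : car -> car;
  df : car -> car;
  deg : nat -> car -> Prop;
  mulDl : forall x y z, mul (x + y) z = mul x z + mul y z;
  mulDr : forall x y z, mul x (y + z) = mul x y + mul x z;
  mulZl : forall r x y, mul (r *: x) y = r *: mul x y;
  mulZr : forall r x y, mul x (r *: y) = r *: mul x y;
  mulA : forall x y z, mul x (mul y z) = mul (mul x y) z;
  mul1x : forall x, mul one x = x;
  mulx1 : forall x, mul x one = x;
  cjD : forall x y, cj (x + y) = cj x + cj y;
  cjZ : forall r x, cj (r *: x) = r *: cj x;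
  cjM : forall x y, cj (mul x y) = mul (cj x) (cj y);
  cjK : forall x, cj (cj x) = x;
  cj1 : cj one = one;
  dfD : forall x y, df (x + y) = df x + df y;
  dfZ : forall r x, df (r *: x) = r *: df x;
  dfM : forall x y, df (mul x y) = mul (df x) y + mul (cj x) (df y);
  dfK : forall x, df (df x) = 0;
  df_cj : forall x, df (cj x) = - cj (df x);
  deg0 : forall n, deg n 0;
  degD : forall n x y, deg n x -> deg n y -> deg n (x + y);
  degZ : forall n r x, deg n x -> deg n (r *: x);
  degM : forall i j x y, deg i x -> deg j y -> deg (i + j) (mul x y);
  deg_one : deg 0 one;
  deg_df : forall n x, deg n.+1 x -> deg n (df x);
  df_deg0 : forall x, deg 0 x -> df x = 0;
  deg_cj : forall n x, deg n x -> cj x = (-1) ^+ n *: x;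
  mulC : forall n x y, deg n x -> mul x y = mul (iter n cj y) x;
  mulxx : forall n x, odd n -> deg n x -> mul x x = 0
}.

Section CdgaTheory.
Variables (R : comNzRingType) (A : cdga R).
Implicit Types x y : A.

Lemma mul0x x : mul 0 x = 0.
Proof. by rewrite -[0 in LHS](scale0r 0) mulZl scale0r. Qed.
Lemma mulx0 x : mul x 0 = 0.
Proof. by rewrite -[0 in LHS](scale0r 0) mulZr scale0r. Qed.
Lemma mulNx x y : mul (- x) y = - mul x y.
Proof. by rewrite -scaleN1r mulZl scaleN1r. Qed.
Lemma mulxN x y : mul x (- y) = - mul x y.
Proof. by rewrite -scaleN1r mulZr scaleN1r. Qed.
Lemma cj0 : cj 0 = 0 :> A.
Proof. by rewrite -[0 in LHS](scale0r 0) cjZ scale0r. Qed.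
Lemma cjN x : cj (- x) = - cj x.
Proof. by rewrite -scaleN1r cjZ scaleN1r. Qed.
Lemma df0 : df 0 = 0 :> A.
Proof. by rewrite -[0 in LHS](scale0r 0) dfZ scale0r. Qed.
Lemma dfN x : df (- x) = - df x.
Proof. by rewrite -scaleN1r dfZ scaleN1r. Qed.
Lemma degN n x : deg n x -> deg n (- x).
Proof. by rewrite -scaleN1r; apply: degZ. Qed.
Lemma df_one : df (one A) = 0.
Proof. exact/df_deg0/deg_one. Qed.
Lemma iter_cjE n x : iter n (@cj R A) x = if odd n then cj x else x.
Proof. by elim: n => //= n ->; case: odd; rewrite ?cjK. Qed.
Lemma mul_deg1 x y : deg 1 x -> mul y x = mul x (cj y).
Proof. by move=> /mulC->; rewrite /= cjK. Qed.

End CdgaTheory.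

(** * Adjoining a variable of degree 1 with prescribed differential *)

Section Adjoin.
Variables (R : comNzRingType) (A : cdga R) (c : R).

(* The pair (a, b) stands for a + t b, where t has degree 1 and dt = c. *)
Definition adj_car : lmodType R := (A * A)%type.
Implicit Types x y z : adj_car.
(** Moving [t] to the left past [a] turns [a] into [cj a], and [t * t = 0] removes the product of
    the two second components. The signs in [adj_cj] and [adj_df] come from the degree of [t] in the
    same way. *)
Definition adj_mul x y : adj_car :=
  (mul x.1 y.1, mul x.2 y.1 + mul (cj x.1) y.2).
Definition adj_one : adj_car := (one A, 0).
Definition adj_cj x : adj_car := (cj x.1, - cj x.2).
Definition adj_df x : adj_car := (df x.1 + c *: x.2, - df x.2).
Definition adj_deg n x : Prop :=
  deg n x.1 /\ if n is n'.+1 then deg n' x.2 else x.2 = 0.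

Lemma pair_eqP (U V : Type) (x y : U * V) : x.1 = y.1 -> x.2 = y.2 -> x = y.
Proof. by case: x y => [? ?] [? ?] /= -> ->. Qed.

Definition adjoin : cdga R.
Proof.
apply: (@Cdga R adj_car adj_mul adj_one adj_cj adj_df adj_deg).
- move=> x y z; apply: pair_eqP; rewrite /= !(mulDl, cjD) //.
  by rewrite addrACA.
- move=> x y z; apply: pair_eqP; rewrite /= !(mulDr) //.
  by rewrite addrACA.
- by move=> r x y; apply: pair_eqP; rewrite /= !(mulZl, cjZ) // scalerDr.
- by move=> r x y; apply: pair_eqP; rewrite /= !mulZr // scalerDr.
- move=> x y z; apply: pair_eqP; rewrite /= ?mulA //.
  by rewrite cjM mulDr mulDl !mulA addrA.
- by move=> x; apply: pair_eqP; rewrite /= ?mul1x // mul0x cj1 mul1x add0r.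
- by move=> x; apply: pair_eqP; rewrite /= ?mulx1 // mulx0 addr0.
- by move=> x y; apply: pair_eqP; rewrite /= ?cjD // opprD.
- by move=> r x; apply: pair_eqP; rewrite /= ?cjZ // scalerN.
- move=> x y; apply: pair_eqP; rewrite /= ?cjM // cjD !cjM opprD.
  by rewrite mulNx mulxN.
- by move=> x; apply: pair_eqP; rewrite /= ?cjK // cjN cjK opprK.
- by apply: pair_eqP; rewrite /= ?cj1 // cj0 oppr0.
- by move=> x y; apply: pair_eqP; rewrite /= ?(dfD, opprD) // scalerDr addrACA.
- move=> r x; apply: pair_eqP; rewrite /= ?dfZ ?scalerN //.
  by rewrite scalerDr !scalerA mulrC.
- move=> x y; apply: pair_eqP => /=.
    rewrite dfM !(mulDl, mulDr) !scalerDr !(mulZl, mulZr) -!addrA.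
    by congr (_ + _); rewrite addrCA.
  rewrite !(dfD, dfM, cjD, cjZ, cjK, df_cj, mulDl, mulDr, mulZl, mulZr).
  rewrite !(mulNx, mulxN) !opprD !opprK scalerN.
  (* Terms 3 and 5 are [c *: mul (cj x.2) y.2] with opposite signs: the Leibniz rule applied to
     [t * t = 0]. *)
  by rewrite !addrA [RHS](ACl (1*4*2*6*(3*5))) /= subrr addr0.
- move=> x; apply: pair_eqP; rewrite /= ?dfN ?dfK ?oppr0 //.
  by rewrite dfD dfZ dfK add0r scalerN addrN.
- move=> x; apply: pair_eqP; rewrite /= ?dfN ?df_cj ?opprK ?cjN //.
  by rewrite cjD cjZ opprD scalerN.
- by move=> [|n]; split; rewrite //=; apply: deg0.
- move=> [|n] x y [? x2] [? y2]; split; rewrite /= ?x2 ?y2 ?addr0 //;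
  exact: degD.
- move=> [|n] r x [? x2]; split; rewrite /= ?x2 ?scaler0 //;
  exact: degZ.
- move=> [|i] [|j] x y [x1 x2] [y1 y2]; split; rewrite /=; try exact: degM.
  + by rewrite x2 y2 mul0x mulx0 addr0.
  + rewrite x2 mul0x add0r (deg_cj x1) scale1r; exact: (degM x1 y2).
  + by rewrite y2 mulx0 addr0; apply: (degM x2 y1).
  + rewrite (deg_cj x1) mulZl; apply: degD; last apply: degZ.
      exact: (degM x2 y1).
    by rewrite addnS -addSn; apply: (degM x1 y2).
- by split=> //=; apply: deg_one.
- move=> n x [x1 x2]; split=> /=.
    by apply: degD; [exact: deg_df | exact: degZ].
  by case: n x1 x2 => [|n] x1 x2; [rewrite df_deg0 ?oppr0 | apply/degN/deg_df].
- move=> x [x1 x2]; apply: pair_eqP; rewrite /= x2 ?df0 ?oppr0 //.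
  by rewrite df_deg0 // scaler0 addr0.
- move=> [|n] x [x1 x2]; apply: pair_eqP; rewrite /= ?(deg_cj x1) //.
    by rewrite x2 cj0 scaler0 oppr0.
  by rewrite (deg_cj x2) exprS mulN1r scaleNr.
- move=> n x y [x1 x2].
  have iterE k z : iter k adj_cj z = (iter k (@cj R A) z.1,
      (-1) ^+ k *: iter k (@cj R A) z.2).
    elim: k => [|k IH] /=; first by rewrite scale1r; case: z.
    by rewrite IH /adj_cj /= cjZ exprS mulN1r scaleNr.
  rewrite iterE; apply: pair_eqP; rewrite /= ?(mulC _ x1) //.
  rewrite addrC mulZl -(mulC _ x1) (deg_cj x1) mulZl; congr (_ + _).
  case: n x1 x2 => [|n] x1 x2; first by rewrite x2 mul0x mulx0.
  by rewrite (mulC _ x2) /= cjK.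
- move=> n x on [x1 x2]; apply: pair_eqP; rewrite /= ?(mulxx on x1) //.
  case: n on x1 x2 => // n on x1 x2; rewrite (mulC _ x2) iter_cjE ifN //.
  by rewrite (deg_cj x1) -signr_odd on expr1 scaleN1r mulNx subrr.
Defined.

End Adjoin.

(** * Koszul algebras *)

Section Koszul.
Variable R : comNzRingType.
Implicit Types s t : seq R.

Definition base_cdga : cdga R.
Proof.
apply: (@Cdga R R^o (fun x y => x * y) 1 id (fun=> 0)
  (fun n x => if n is 0 then True else x = 0)) => //.
- exact: mulrDl.
- exact: mulrDr.
- by move=> r x y; rewrite /GRing.scale /= mulrA.
- by move=> r x y; rewrite /GRing.scale /= mulrCA.
- exact: mulrA.
- exact: mul1r.
- exact: mulr1.
- by move=> *; rewrite addr0.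
- by move=> *; rewrite scaler0.
- by move=> *; rewrite mul0r mulr0 addr0.
- by move=> x; rewrite oppr0.
- by case.
- by case=> // n x y -> ->; rewrite addr0.
- by case=> // n r x ->; rewrite scaler0.
- by case=> [|i] [|j] x y //= => [_ ->|->|->]; rewrite ?mulr0 ?mul0r.
- by case=> [|n] x.
- by case=> [|n] x /= => [_|->]; rewrite ?scale1r ?scaler0.
- by move=> n x y _; rewrite mulrC; congr (_ * _); elim: n.
- by case=> // n x _ ->; rewrite mulr0.
Defined.

(* The head of the list is the generator adjoined last, so the Koszul algebra
   of a regular sequence s is koszul (rev s). *)
Fixpoint koszul (s : seq R) : cdga R :=
  if s is c :: s' then adjoin (koszul s') c else base_cdga.

Definition acyclic (A : cdga R) : Prop :=
  forall n (x : A), deg n.+1 x -> df x = 0 ->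
  exists2 y, deg n.+2 y & df y = x.

(** The coefficient of [one], read off on all elements; on degree 0 it inverts [r |-> r *: one]. *)
Fixpoint aug s : koszul s -> R :=
  if s is c :: s' then fun x : koszul (c :: s') => aug x.1 else id.

Lemma augD s (x y : koszul s) : aug (x + y) = aug x + aug y.
Proof. by elim: s x y => //= c s IH x y; apply: IH. Qed.
Lemma augZ s r (x : koszul s) : aug (r *: x) = r * aug x.
Proof. by elim: s x => //= c s IH x; apply: IH. Qed.
Lemma aug_one s : aug (one (koszul s)) = 1.
Proof. by elim: s. Qed.
Lemma aug_deg0 s (x : koszul s) : deg 0 x -> x = aug x *: one _.
Proof.
elim: s x => [|c s IH] x /=; first by rewrite /GRing.scale /= mulr1.
by move=> [/IH x1 x2]; apply: pair_eqP; rewrite /= ?x2 ?scaler0.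
Qed.

Lemma ideal_gen_cons (c : R) s x :
  ideal_gen (c :: s) x <-> exists a b, ideal_gen s b /\ x = c * a + b.
Proof.
split=> [[a ->]|[a [b [[u ->] ->]]]].
  exists (a ord0), (\sum_(i < size s) a (lift ord0 i) * s`_i); split.
    by exists (fun i => a (lift ord0 i)).
  by rewrite big_ord_recl mulrC.
exists (fun i => if unlift ord0 i is Some j then u j else a).
rewrite big_ord_recl unlift_none mulrC; congr (_ + _).
by apply: eq_bigr => i _; rewrite liftK.
Qed.

(** Computes the homology in degree 0, on which [acyclic] is silent, as R modulo the ideal of [s];
    it translates between ideal membership and boundaries. *)
Lemma koszul_boundary0 s r :
  ideal_gen s r <-> exists2 x : koszul s, deg 1 x & df x = r *: one _.
Proof.
elim: s r => [|c s IH] r /=.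
  split=> [[u ->]|[x _ /esym]]; rewrite ?big_ord0.
    by exists 0; rewrite ?scale0r.
  rewrite /GRing.scale /= mulr1 => ->.
  by exists (fun=> 0); rewrite big_ord0.
rewrite ideal_gen_cons; split=> [[a [b [/IH[x x1 dx] ->]]]|[x [/= x1 x2] dx]].
  exists ((x, a *: one _) : koszul (c :: s)).
    by split=> //=; apply/degZ/deg_one.
  apply: pair_eqP; rewrite /= ?dfZ ?df_one ?scaler0 ?oppr0 //.
  by rewrite dx scalerA addrC scalerDl.
exists (aug x.2), (r - c * aug x.2); split; last by rewrite subrKC.
apply/IH; exists x.1 => //; move: dx => /(congr1 fst) /= dx.
by rewrite scalerBl -dx -scalerA -aug_deg0 // addrK.
Qed.

(** The mapping cone argument for multiplication by [c]. In a cycle [x.1 + t x.2] the part [x.2] is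
    a cycle. It bounds some [b]: in positive degree by acyclicity, in degree 0 because
    [c *: x.2 = - df x.1] bounds and [c] is regular modulo the ideal. Then [x.1 + c *: b] is a cycle
    of the smaller algebra. *)
Lemma koszul_acyclic_cons c s :
  acyclic (koszul s) -> regular_mod (ideal_gen s) c ->
  acyclic (koszul (c :: s)).
Proof.
move=> acS regc n x [/= x1 x2] dx.
have /= dx1 := congr1 fst dx; have /= /eqP := congr1 snd dx.
rewrite oppr_eq0 => /eqP dx2.
have [b b1 db] : exists2 b : koszul s, deg n.+1 b & df b = x.2.
  case: n x1 x2 => [|n] x1 x2; last exact: acS.
  have [b b1 db] : exists2 b : koszul s, deg 1 b & df b = aug x.2 *: one _.
    apply/koszul_boundary0/regc/koszul_boundary0; exists (- x.1).
      exact: degN.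
    rewrite dfN -scalerA -aug_deg0 //; apply/eqP.
    by rewrite eqr_oppLR -addr_eq0 dx1.
  by exists b => //; rewrite db -aug_deg0.
have [a a1 da] : exists2 a, deg n.+2 a & df a = x.1 + c *: b.
  by apply: acS; [apply: degD => //; apply: degZ | rewrite dfD dfZ db].
exists ((a, - b) : koszul (c :: s)); first by split=> //; apply: degN.
by apply: pair_eqP; rewrite /= ?dfN ?opprK // da scalerN addrK.
Qed.

Lemma koszul_nil_acyclic : acyclic (koszul [::]).
Proof. by move=> n x /= -> _; exists 0. Qed.

Lemma ideal_gen_min s (J : set R) :
  ideal J -> (forall c, c \in s -> J c) -> ideal_gen s `<=` J.
Proof.
move=> [J0 JD]; elim: s => [|c s IH] Js x.
  by move=> [u ->]; rewrite big_ord0.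
move=> /ideal_gen_cons[a [b [sb ->]]]; rewrite mulrC; apply: JD.
  by apply: Js; rewrite mem_head.
by apply: IH sb => d ds; apply: Js; rewrite inE ds orbT.
Qed.

Lemma ideal_ideal_gen (s : seq R) : ideal (ideal_gen s).
Proof.
split; first by exists (fun=> 0); rewrite big1 // => i _; rewrite mul0r.
move=> a _ _ [u ->] [v ->]; exists (fun i => a * u i + v i).
rewrite mulr_sumr -big_split; apply: eq_bigr => i _ /=.
by rewrite mulrDl mulrA.
Qed.

Lemma mem_ideal_gen s c : c \in s -> ideal_gen s c.
Proof.
elim: s => // d s IH; rewrite inE ideal_gen_cons => /orP[/eqP->|/IH sc].
  by exists 1, 0; rewrite mulr1 addr0; split=> //; case: (ideal_ideal_gen s).
by exists 0, c; rewrite mulr0 add0r.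
Qed.

Lemma eq_ideal_gen s t : s =i t -> ideal_gen s = ideal_gen t.
Proof.
move=> st; apply/seteqP; split; apply: ideal_gen_min => [|c].
- exact: ideal_ideal_gen.
- by rewrite st; apply: mem_ideal_gen.
- exact: ideal_ideal_gen.
- by rewrite -st; apply: mem_ideal_gen.
Qed.

Lemma koszul_acyclic s :
  (forall i, (i < size s)%N -> regular_mod (ideal_gen (take i s)) s`_i) ->
  acyclic (koszul (rev s)).
Proof.
elim/last_ind: s => [_|s c IH regs]; first exact: koszul_nil_acyclic.
rewrite rev_rcons; apply: koszul_acyclic_cons.
  apply: IH => i lis; have := regs i.
  rewrite size_rcons nth_rcons lis -cats1 takel_cat ?(ltnW lis) //.
  by apply; apply: leqW.
have := regs (size s); rewrite size_rcons nth_rcons ltnn eqxx.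
rewrite -cats1 takel_cat // take_size (eq_ideal_gen (mem_rev s)).
exact.
Qed.

End Koszul.

(** * Maps out of Koszul algebras and the fibre product *)

Section KoszulMap.
Variables (R : comNzRingType) (A : cdga R) (z : R -> A).
Implicit Type s : seq R.

(** Koszul algebras are free as strictly commutative graded algebras, so a morphism is fixed by the
    images of the generators. The images [z] are indexed by ring elements, hence equal entries of
    [s] share one. *)
Fixpoint kmap s : koszul s -> A :=
  if s is c :: s' then
    fun x : koszul (c :: s') => kmap x.1 + mul (z c) (kmap x.2)
  else fun r => r *: one A.

Lemma kmapD s (x y : koszul s) : kmap (x + y) = kmap x + kmap y.
Proof.
elim: s x y => [|c s IH] x y /=; first exact: scalerDl.
by rewrite !IH mulDr addrACA.
Qed.

Lemma kmapZ s r (x : koszul s) : kmap (r *: x) = r *: kmap x.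
Proof.
elim: s x => [|c s IH] x /=; first by rewrite scalerA.
by rewrite !IH mulZr scalerDr.
Qed.

Lemma kmap0 s : kmap (0 : koszul s) = 0.
Proof. by rewrite -[0 in LHS](scale0r 0) kmapZ scale0r. Qed.

Lemma kmapN s (x : koszul s) : kmap (- x) = - kmap x.
Proof. by rewrite -scaleN1r kmapZ scaleN1r. Qed.

Lemma kmap_one s : kmap (one (koszul s)) = one A.
Proof. by elim: s => /= [|c s ->]; rewrite ?scale1r // kmap0 mulx0 addr0. Qed.

Definition koszul_lift s : Prop :=
  forall c, c \in s -> deg 1 (z c) /\ df (z c) = c *: one A.

Lemma koszul_lift_cons c s : koszul_lift (c :: s) ->
  [/\ deg 1 (z c), df (z c) = c *: one A & koszul_lift s].
Proof.
move=> zs; have [z1 dz] := zs c (mem_head c s).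
by split=> // d ds; apply: zs; rewrite inE ds orbT.
Qed.

Lemma kmap_cj s (x : koszul s) : koszul_lift s -> kmap (cj x) = cj (kmap x).
Proof.
elim: s x => [|c s IH] x /=; first by rewrite cjZ cj1.
move=> /koszul_lift_cons[z1 _ zs]; rewrite kmapN !IH // cjD cjM.
by rewrite (deg_cj z1) expr1 scaleN1r mulNx mulxN.
Qed.

Lemma kmapM s (x y : koszul s) :
  koszul_lift s -> kmap (mul x y) = mul (kmap x) (kmap y).
Proof.
elim: s x y => [|c s IH] x y /=.
  by rewrite mulZl mul1x scalerA.
move=> /koszul_lift_cons[z1 _ zs].
rewrite kmapD !IH // kmap_cj // !(mulDl, mulDr) -!addrA; congr (_ + _).
rewrite -!(mulA (z c)).
rewrite [mul (kmap x.1) (mul (z c) _)]mulA (mul_deg1 _ z1) -mulA addrCA.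
congr (_ + _); rewrite [mul (kmap x.2) (mul (z c) _)]mulA (mul_deg1 _ z1).
(* The square of [z c] appears here, and strictness of [A] kills it. *)
by rewrite -mulA [X in _ + X]mulA (mulxx _ z1) // mul0x addr0.
Qed.

Lemma kmap_df s (x : koszul s) : koszul_lift s -> kmap (df x) = df (kmap x).
Proof.
elim: s x => [|c s IH] x /=; first by rewrite scale0r dfZ df_one scaler0.
move=> /koszul_lift_cons[z1 dz zs]; rewrite kmapD kmapZ kmapN !IH //.
rewrite dfD dfM dz mulZl mul1x (deg_cj z1) expr1 scaleN1r mulNx mulxN.
by rewrite addrA.
Qed.

Lemma kmap_deg s n (x : koszul s) :
  koszul_lift s -> deg n x -> deg n (kmap x).
Proof.
elim: s n x => [|c s IH] n x /=.
  case: n => [|n] _ => [_|->]; first by apply: degZ; apply: deg_one.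
  by rewrite scale0r; apply: deg0.
move=> /koszul_lift_cons[z1 _ zs] [x1 x2]; apply: degD; first exact: IH.
case: n x1 x2 => [|n] x1 x2; first by rewrite x2 kmap0 mulx0; apply: deg0.
exact: (degM z1 (IH _ _ zs x2)).
Qed.

End KoszulMap.

(** Freeness over R; applied to K(l), it makes [y] recoverable from [psi u + f y]. *)
Lemma koszul_torsion_free (R : comNzRingType) (f : R) (s : seq R) :
  GRing.lreg f -> injective (fun x : koszul s => f *: x).
Proof.
move=> regf; elim: s => [|c s IH] x y; first exact: regf.
by move=> xy; apply: pair_eqP; apply: IH;
  [have := congr1 fst xy | have := congr1 snd xy].
Qed.

Section Glue.
Variables (R : comNzRingType) (E L : cdga R) (f : R).
Variables (psi xi : E -> L).

(* The pair (u, y) stands for the element (u, psi u + f y) of the fibre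
   product of E and L over L/fL. *)
Definition glue_car : lmodType R := (E * L)%type.
Implicit Types x y : glue_car.
Definition glue_snd x : L := psi x.1 + f *: x.2.
(** Obtained by expanding [(psi u + f y)(psi u' + f y')] and dividing what is not [psi (u u')] by
    [f]. Likewise [d (psi u + f y) = psi (d u) + f (d y - xi u)], as [psi] is a chain map only up to
    [f *: xi]; this gives [glue_df]. *)
Definition glue_mul x y : glue_car :=
  (mul x.1 y.1, mul (psi x.1) y.2 + mul x.2 (psi y.1) + f *: mul x.2 y.2).
Definition glue_one : glue_car := (one E, 0).
Definition glue_cj x : glue_car := (cj x.1, cj x.2).
Definition glue_df x : glue_car := (df x.1, df x.2 - xi x.1).
Definition glue_deg n x : Prop := deg n x.1 /\ deg n x.2.

Hypothesis f_inj : injective (fun y : L => f *: y).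
Hypothesis psiD : forall u v, psi (u + v) = psi u + psi v.
Hypothesis psiZ : forall r u, psi (r *: u) = r *: psi u.
Hypothesis psiM : forall u v, psi (mul u v) = mul (psi u) (psi v).
Hypothesis psi1 : psi (one E) = one L.
Hypothesis psi_cj : forall u, psi (cj u) = cj (psi u).
Hypothesis psi_deg : forall n u, deg n u -> deg n (psi u).
Hypothesis psi_df : forall u, psi (df u) = df (psi u) + f *: xi u.
Hypothesis xi_deg : forall n u, deg n.+1 u -> deg n (xi u).

(** It reduces each identity required of [glue] to the same identity in [E] and in [L], so that
    [glue_mul] never has to be expanded in an associativity or Leibniz computation. *)
Lemma glue_inj x y : x.1 = y.1 -> glue_snd x = glue_snd y -> x = y.
Proof.
move=> xy1 xy2; apply: pair_eqP => //; apply: f_inj.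
by move: xy2; rewrite /glue_snd xy1 => /addrI.
Qed.

Lemma glue_sndD x y : glue_snd (x + y) = glue_snd x + glue_snd y.
Proof. by rewrite /glue_snd psiD scalerDr addrACA. Qed.

Lemma glue_sndZ r x : glue_snd (r *: x) = r *: glue_snd x.
Proof. by rewrite /glue_snd psiZ scalerDr !scalerA mulrC. Qed.

Lemma glue_sndM x y : glue_snd (glue_mul x y) = mul (glue_snd x) (glue_snd y).
Proof.
rewrite /glue_snd /= psiM !(mulDl, mulDr) !scalerDr !(mulZl, mulZr).
by rewrite !addrA.
Qed.

Lemma glue_snd_one : glue_snd glue_one = one L.
Proof. by rewrite /glue_snd psi1 scaler0 addr0. Qed.

Lemma glue_snd_cj x : glue_snd (glue_cj x) = cj (glue_snd x).
Proof. by rewrite /glue_snd psi_cj cjD cjZ. Qed.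

Lemma glue_snd_df x : glue_snd (glue_df x) = df (glue_snd x).
Proof.
rewrite /glue_snd psi_df dfD dfZ scalerBr -addrA; congr (_ + _).
by rewrite addrC subrK.
Qed.

Lemma glue_snd0 : glue_snd 0 = 0.
Proof. by rewrite -[0 in LHS](scale0r 0) glue_sndZ scale0r. Qed.

Lemma glue_sndN x : glue_snd (- x) = - glue_snd x.
Proof. by rewrite -scaleN1r glue_sndZ scaleN1r. Qed.

Lemma glue_snd_deg n x : glue_deg n x -> deg n (glue_snd x).
Proof.
by move=> [x1 x2]; apply: degD; [apply: psi_deg | apply: degZ].
Qed.

Let glueE := (glue_sndD, glue_sndZ, glue_sndM, glue_snd_one, glue_snd_cj,
  glue_snd_df, glue_snd0, glue_sndN).

Definition glue : cdga R.
Proof.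
apply: (@Cdga R glue_car glue_mul glue_one glue_cj glue_df glue_deg).
- by move=> *; apply: glue_inj; rewrite ?glueE /= mulDl.
- by move=> *; apply: glue_inj; rewrite ?glueE /= mulDr.
- by move=> *; apply: glue_inj; rewrite ?glueE /= mulZl.
- by move=> *; apply: glue_inj; rewrite ?glueE /= mulZr.
- by move=> *; apply: glue_inj; rewrite ?glueE /= mulA.
- by move=> *; apply: glue_inj; rewrite ?glueE /= mul1x.
- by move=> *; apply: glue_inj; rewrite ?glueE /= mulx1.
- by move=> *; apply: glue_inj; rewrite ?glueE /= cjD.
- by move=> *; apply: glue_inj; rewrite ?glueE /= cjZ.
- by move=> *; apply: glue_inj; rewrite ?glueE /= cjM.
- by move=> *; apply: glue_inj; rewrite ?glueE /= cjK.
- by apply: glue_inj; rewrite ?glueE /= cj1.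
- by move=> *; apply: glue_inj; rewrite ?glueE /= dfD.
- by move=> *; apply: glue_inj; rewrite ?glueE /= dfZ.
- by move=> *; apply: glue_inj; rewrite ?glueE /= dfM.
- by move=> *; apply: glue_inj; rewrite ?glueE /= dfK.
- by move=> *; apply: glue_inj; rewrite ?glueE /= df_cj.
- by split; apply: deg0.
- by move=> n x y [? ?] [? ?]; split; apply: degD.
- by move=> n r x [? ?]; split; apply: degZ.
- move=> i j x y [x1 x2] [y1 y2]; split; first exact: degM.
  by apply: degD; [apply: degD | apply: degZ]; apply: degM => //;
    apply: psi_deg.
- by split; [apply: deg_one | apply: deg0].
- move=> n x [x1 x2]; split; first exact: deg_df.
  apply: degD; first exact: deg_df.
  exact/degN/xi_deg.
- move=> x x0; have [x1 x2] := x0; apply: glue_inj; rewrite ?glueE /=.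
    exact: df_deg0.
  exact/df_deg0/glue_snd_deg.
- move=> n x x0; have [x1 x2] := x0; apply: glue_inj; rewrite ?glueE /=.
    exact: deg_cj.
  exact/deg_cj/glue_snd_deg.
- move=> n x y x0; have [x1 x2] := x0; apply: glue_inj; rewrite ?glueE /=.
    by rewrite (mulC _ x1); congr mul; elim: {x0 x1 x2} n => //= n ->.
  rewrite (mulC _ (glue_snd_deg x0)); congr mul.
  by elim: {x0 x1 x2} n => //= n ->; rewrite glueE.
- move=> n x on x0; have [x1 x2] := x0; apply: glue_inj; rewrite ?glueE /=.
    exact: mulxx x1.
  exact/(mulxx on)/glue_snd_deg.
Defined.

End Glue.

(** * Homogeneous coordinates *)

(* Common setting for the local and the graded case: hpart z is the homogeneous
   part of degree z and pr z the projection onto it. A local ring is recovered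
   with hpart z = R and pr z = id for all z. *)
Record homog_setting (R : comNzRingType) (m : set R) := HomogSetting {
  hpart : int -> set R;
  pr : int -> R -> R;
  m_ideal : ideal m;
  m_proper : ~ m 1;
  hpartM : forall z w x y, hpart z x -> hpart w y -> hpart (z + w) (x * y);
  hpart1 : hpart 0 1;
  prD : forall z x y, pr z (x + y) = pr z x + pr z y;
  prM : forall z w x y, hpart w y -> pr (z + w) (x * y) = pr z x * y;
  hpart_pr : forall z x, hpart z (pr z x);
  pr_id : forall z x, hpart z x -> pr z x = x;
  pr_m : forall z x, m x -> m (pr z x);
  hpart_unit : forall z x, hpart z x -> m x \/ exists y, x * y = 1
}.

Section HomogTheory.
Variables (R : comNzRingType) (m : set R) (H : homog_setting m).
Implicit Types (x y : R) (z w : int).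

Lemma m0 : m 0.
Proof. by case: (m_ideal H). Qed.
Lemma mD x y : m x -> m y -> m (x + y).
Proof. by rewrite -{2}[x]mul1r; case: (m_ideal H) => _; apply. Qed.
Lemma mM x y : m y -> m (x * y).
Proof. by rewrite -[x * y]addr0 => my; case: (m_ideal H) => a; apply. Qed.
Lemma mMl x y : m x -> m (x * y).
Proof. by rewrite mulrC; apply: mM. Qed.
Lemma mN x : m x -> m (- x).
Proof. by rewrite -mulN1r; apply: mM. Qed.

Lemma pr0 z : pr H z 0 = 0.
Proof. by apply: (addrI (pr H z 0)); rewrite -prD !addr0. Qed.
Lemma hpart0 z : hpart H z 0.
Proof. by rewrite -(pr0 z); apply: hpart_pr. Qed.
Lemma hpartD z x y : hpart H z x -> hpart H z y -> hpart H z (x + y).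
Proof. by move=> /pr_id<- /pr_id<-; rewrite -prD; apply: hpart_pr. Qed.
Lemma prN z x : pr H z (- x) = - pr H z x.
Proof. by apply: (addrI (pr H z x)); rewrite -prD !addrN pr0. Qed.
Lemma hpartN z x : hpart H z x -> hpart H z (- x).
Proof. by move=> /pr_id<-; rewrite -prN; apply: hpart_pr. Qed.

Lemma pr_sum z (I : Type) (r : seq I) (F : I -> R) :
  pr H z (\sum_(i <- r) F i) = \sum_(i <- r) pr H z (F i).
Proof. exact: (big_morph _ (prD H z) (pr0 z)). Qed.

Variable dg : R -> int.
Implicit Type s : seq R.

(** [dg] chooses one degree per ring element, since degrees need not be unique: 0 has all of them,
    and in the local setting so does every element. *)
Definition graded_seq s := forall c, c \in s -> hpart H (dg c) c.

Lemma graded_seq_cons c s :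
  graded_seq (c :: s) -> hpart H (dg c) c /\ graded_seq s.
Proof.
move=> hs; split=> [|d ds]; apply: hs; first exact: mem_head.
by rewrite inE ds orbT.
Qed.

Fixpoint hom s : int -> koszul s -> Prop :=
  if s is c :: s' then
    fun z (x : koszul (c :: s')) => hom z x.1 /\ hom (z - dg c) x.2
  else hpart H.

Fixpoint coef_m s : koszul s -> Prop :=
  if s is c :: s' then
    fun x : koszul (c :: s') => coef_m x.1 /\ coef_m x.2
  else m.

Lemma hom0 s z : hom z (0 : koszul s).
Proof. by elim: s z => [|c s IH] z /=; [apply: hpart0 | split]. Qed.

Lemma homD s z (x y : koszul s) : hom z x -> hom z y -> hom z (x + y).
Proof.
elim: s z x y => [|c s IH] z x y /=; first exact: hpartD.
by move=> [? ?] [? ?]; split; apply: IH.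
Qed.

Lemma homZ s z w r (x : koszul s) :
  hpart H w r -> hom z x -> hom (w + z) (r *: x).
Proof.
elim: s z x => [|c s IH] z x /= rw; first exact: hpartM.
by move=> [? ?]; split; last rewrite -addrA; apply: IH.
Qed.

Lemma homN s z (x : koszul s) : hom z x -> hom z (- x).
Proof.
rewrite -scaleN1r -{2}[z]add0r; apply: homZ.
exact/hpartN/hpart1.
Qed.

Lemma hom_cj s z (x : koszul s) : hom z x -> hom z (cj x).
Proof.
elim: s z x => //= c s IH z x [x1 x2].
by split; [apply: IH | apply/homN/IH].
Qed.

Lemma homM s z w (x y : koszul s) :
  hom z x -> hom w y -> hom (z + w) (mul x y).
Proof.
elim: s z w x y => [|c s IH] z w x y /=; first exact: hpartM.
move=> [x1 x2] [y1 y2]; split; first exact: IH.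
apply: homD; first by rewrite addrAC; apply: IH.
by rewrite -addrA; apply: IH => //; apply: hom_cj.
Qed.

Lemma hom_one s : hom 0 (one (koszul s)).
Proof. by elim: s => [|c s IH] /=; [apply: hpart1|split=> //; apply: hom0]. Qed.

Lemma hom_df s z (x : koszul s) : graded_seq s -> hom z x -> hom z (df x).
Proof.
elim: s z x => [|c s IH] z x /=; first by move=> *; apply: hpart0.
move=> /graded_seq_cons[cs hs] [x1 x2]; split; last exact/homN/IH.
apply: homD; first exact: IH.
by rewrite -(subrKC (dg c) z); apply: homZ.
Qed.

Lemma hom_aug s z (x : koszul s) : hom z x -> hpart H z (aug x).
Proof. by elim: s x => //= c s IH x [/IH]. Qed.

Lemma coef_m0 s : coef_m (0 : koszul s).
Proof. by elim: s => [|c s IH] /=; [apply: m0 | split]. Qed.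

Lemma coef_mD s (x y : koszul s) : coef_m x -> coef_m y -> coef_m (x + y).
Proof.
elim: s x y => [|c s IH] x y /=; first exact: mD.
by move=> [? ?] [? ?]; split; apply: IH.
Qed.

Lemma coef_mZ s r (x : koszul s) : coef_m x -> coef_m (r *: x).
Proof.
elim: s x => [|c s IH] x /=; first exact: mM.
by move=> [? ?]; split; apply: IH.
Qed.

Lemma coef_mZl s r (x : koszul s) : m r -> coef_m (r *: x).
Proof.
elim: s x => [|c s IH] x rm /=; first exact: mMl.
by split; apply: IH.
Qed.

Lemma coef_mN s (x : koszul s) : coef_m x -> coef_m (- x).
Proof. by rewrite -scaleN1r; apply: coef_mZ. Qed.

Lemma coef_m_cj s (x : koszul s) : coef_m x -> coef_m (cj x).
Proof.
elim: s x => //= c s IH x [x1 x2].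
by split; [apply: IH | apply/coef_mN/IH].
Qed.

Lemma coef_mM s (x y : koszul s) : coef_m x -> coef_m (mul x y).
Proof.
elim: s x y => [|c s IH] x y /=; first exact: mMl.
move=> [x1 x2]; split; first exact: IH.
by apply: coef_mD; apply: IH => //; apply: coef_m_cj.
Qed.

Lemma coef_m_df s (x : koszul s) :
  (forall c, c \in s -> m c) -> coef_m (df x).
Proof.
elim: s x => [|c s IH] x /= ms; first exact: m0.
have dm (y : koszul s) : coef_m (df y).
  by apply: IH => d ds; apply: ms; rewrite inE ds orbT.
split; last exact: coef_mN.
by apply: coef_mD => //; apply/coef_mZl/ms/mem_head.
Qed.

Lemma coef_m_aug s (x : koszul s) : coef_m x -> m (aug x).
Proof. by elim: s x => //= c s IH x [/IH]. Qed.

(* hd z x means that x is homogeneous of degree z, and cm x that its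
   coefficients lie in m. *)
Record frame (V : lmodType R) (P : V -> Prop) (hd : int -> V -> Prop)
    (cm : V -> Prop) (r : nat) := Frame {
  fe : 'I_r -> int;
  fg : 'rV[R]_r -> V;
  fh : V -> 'rV[R]_r;
  fg_linear : linear fg;
  fh_linear : linear fh;
  fgK : forall v, fh (fg v) = v;
  fgP : forall v, P (fg v);
  fhK : forall x : V, P x -> fg (fh x) = x;
  fg_hom : forall z (v : 'rV[R]_r),
    (forall i, hpart H (z - fe i) (v 0 i)) -> hd z (fg v);
  fh_hom : forall z (x : V) i, P x -> hd z x -> hpart H (z - fe i) (fh x 0 i);
  fh_m : forall (x : V) i, cm x -> m (fh x 0 i)
}.

Lemma frame_transport (V V' : lmodType R) (P : V -> Prop) (P' : V' -> Prop)
    hd hd' (cm : V -> Prop) (cm' : V' -> Prop) r (a : V -> V') (b : V' -> V) :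
    linear a -> linear b -> (forall u : V, P u -> b (a u) = u) ->
    (forall u : V, P u -> P' (a u)) ->
    (forall v : V', P' v -> P (b v)) -> (forall v : V', P' v -> a (b v) = v) ->
    (forall z (u : V), P u -> hd z u -> hd' z (a u)) ->
    (forall z (v : V'), P' v -> hd' z v -> hd z (b v)) ->
    (forall v : V', cm' v -> cm (b v)) ->
  frame P hd cm r -> frame P' hd' cm' r.
Proof.
move=> aL bL abK aP bP baK ah bh bm F.
apply: (@Frame _ _ _ _ r (fe F) (a \o fg F) (fh F \o b)) => /=.
- by move=> k u v; rewrite /= (fg_linear F) aL.
- by move=> k u v; rewrite /= bL (fh_linear F).
- by move=> v; rewrite abK ?fgK //; apply: fgP.
- by move=> v; apply: aP; apply: fgP.
- by move=> v Pv; rewrite fhK ?baK //; apply: bP.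
- by move=> z v hv; apply: ah; [apply: fgP | apply: fg_hom].
- by move=> z v i Pv hv; apply: fh_hom; [apply: bP | apply: bh].
- by move=> v i /bm; apply: fh_m.
Qed.

Lemma frame_sum (V1 V2 : lmodType R) (P1 : V1 -> Prop) (P2 : V2 -> Prop)
    hd1 hd2 cm1 cm2 r1 r2 (d : int) :
    frame P1 hd1 cm1 r1 -> frame P2 hd2 cm2 r2 ->
  @frame (V1 * V2)%type (fun u => P1 u.1 /\ P2 u.2)
    (fun z u => hd1 z u.1 /\ hd2 (z - d) u.2)
    (fun u => cm1 u.1 /\ cm2 u.2) (r1 + r2).
Proof.
move=> F1 F2.
pose e i := match split i with inl j => fe F1 j | inr j => fe F2 j + d end.
apply: (@Frame _ _ _ _ (r1 + r2) e
  (fun v => (fg F1 (lsubmx v), fg F2 (rsubmx v)))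
  (fun u => row_mx (fh F1 u.1) (fh F2 u.2))) => /=.
- by move=> k u v; rewrite /= !linearP (fg_linear F1) (fg_linear F2).
- move=> k u v; rewrite /= (fh_linear F1) (fh_linear F2).
  by rewrite scale_row_mx add_row_mx.
- by move=> v; rewrite !fgK hsubmxK.
- by move=> v; split; apply: fgP.
- by move=> [x1 x2] [P1x P2x]; rewrite row_mxKl row_mxKr !fhK.
- move=> z v hv; split; apply: fg_hom => i.
    by have := hv (lshift r2 i); rewrite /e (unsplitK (inl i)) mxE.
  have := hv (rshift r1 i); rewrite /e (unsplitK (inr i)) mxE.
  by rewrite opprD addrCA addrC addrAC.
- move=> z x i [P1x P2x] [h1 h2]; rewrite mxE /e; case: splitP => j ij.
    exact: fh_hom.
  by rewrite opprD addrCA addrC; apply: fh_hom.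
- by move=> x i [? ?]; rewrite mxE; case: splitP => j _; apply: fh_m.
Qed.

Lemma frame0 (V : lmodType R) (hd : int -> V -> Prop) cm :
  (forall z, hd z 0) -> frame (fun u => u = 0) hd cm 0.
Proof.
move=> hd0.
apply: (@Frame _ _ _ _ 0 (fun=> 0) (fun=> 0) (fun=> 0)) => //.
- by move=> k u v; rewrite /= scaler0 addr0.
- by move=> k u v; rewrite /= scaler0 addr0.
- by move=> v; rewrite thinmx0.
- by move=> z x [].
- by move=> x [].
Qed.

Lemma koszul_frame s n :
  {r & frame (fun x : koszul s => deg n x) (@hom s) (@coef_m s) r}.
Proof.
elim: s n => [|c s IH] n /=.
  case: n => [|n]; last first.
    by exists 0; apply: frame0 => z; apply: hpart0.
  exists 1%N; apply: (@Frame (koszul [::]) _ (@hom [::]) (@coef_m [::]) 1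
    (fun=> 0) (fun v : 'rV[R]_1 => v 0 0) (fun r : R => r%:M)) => //.
  - by move=> k u v; rewrite !mxE.
  - by move=> k u v; rewrite raddfD /= -scale_scalar_mx.
  - by move=> v; rewrite -mx11_scalar.
  - by move=> x _; rewrite mxE mulr1n.
  - by move=> z v /(_ 0); rewrite subr0.
  - by move=> z x i _ hx; rewrite subr0 ord1 mxE mulr1n.
  - by move=> x i; rewrite ord1 mxE mulr1n.
case: n => [|n].
  have [r F] := IH 0%N; exists (r + 0)%N.
  have F0 : frame (fun u : koszul s => u = 0) (@hom s) (@coef_m s) 0.
    by apply: frame0 => z; apply: hom0.
  exact: (frame_sum (dg c) F F0).
have [r F] := IH n.+1; have [r' F'] := IH n; exists (r + r')%N.
exact: (frame_sum (dg c) F F').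
Qed.

End HomogTheory.

(** * Uniqueness of minimal resolutions *)

(** Chain maps and homotopies are built degree by degree, with matrix sizes depending on the degree.
    [Q] is the invariant that makes the next step possible, [S] the relation between neighbours. *)
Lemma dependent_choice_seq (T : nat -> Type) (Q : forall n, T n -> Prop)
    (S : forall n, T n -> T n.+1 -> Prop) (x0 : T 0%N) :
  Q 0%N x0 -> (forall n x, Q n x -> exists2 y, Q n.+1 y & S n x y) ->
  exists x : forall n, T n,
    x 0%N = x0 /\ forall n, Q n (x n) /\ S n (x n) (x n.+1).
Proof.
move=> Qx0 step.
have next n (x : {x | Q n x}) : {y : {y | Q n.+1 y} | S n (sval x) (sval y)}.
  apply: cid; have [y Qy Sy] := step n _ (svalP x).
  by exists (exist _ y Qy).
pose X := fix X n : {x | Q n x} :=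
  if n is n'.+1 then sval (next n' (X n')) else exist _ x0 Qx0.
exists (fun n => sval (X n)); split=> // n; split; first exact: svalP.
exact: (svalP (next n (X n))).
Qed.

Section Uniqueness.
Variables (R : comNzRingType) (m : set R) (H : homog_setting m).

Lemma det_congr n (A B : 'M[R]_n) :
  (forall i j, m (A i j - B i j)) -> m (\det A - \det B).
Proof.
move=> AB; rewrite /determinant -sumrB.
apply: big_ind; [exact: (m0 H) | exact: (mD H) | move=> s _].
rewrite -mulrBr; apply: (mM H).
apply: (big_rec2 (fun x y => m (x - y))) => [|i x y _ mxy].
  by rewrite subrr; apply: (m0 H).
rewrite -(subrK (A i (s i) * y) (_ * x)) -addrA -mulrBl -mulrBr.
by apply: (mD H); [apply: (mM H) | apply: (mMl H)].
Qed.

Lemma hpart_prod (I : Type) (r : seq I) (F : I -> R) (z : I -> int) :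
  (forall i, hpart H (z i) (F i)) ->
  hpart H (\sum_(i <- r) z i) (\prod_(i <- r) F i).
Proof.
move=> hF; apply: (big_rec2 (fun w x => hpart H w x)); first exact: hpart1.
by move=> i w x _; apply: hpartM.
Qed.

(** The term of a permutation [s] has degree the sum of the [e i - e (s i)], which is 0 after
    reindexing. *)
Lemma hpart_det n (e : 'I_n -> int) (A : 'M[R]_n) :
  (forall i j, hpart H (e i - e j) (A i j)) -> hpart H 0 (\det A).
Proof.
move=> hA; apply: (big_ind (hpart H 0)) => [||s _].
- exact: hpart0.
- exact: hpartD.
- rewrite -[0]addr0; apply: hpartM.
    rewrite -signr_odd; case: odd; last exact: hpart1.
    exact/hpartN/hpart1.
  have -> : 0 = \sum_i (e i - e (s i)).
    by rewrite sumrB [X in _ - X](reindex_inj (@perm_inj _ s^-1)) /=;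
      under [X in _ - X]eq_bigr do rewrite permKV; rewrite subrr.
  exact: hpart_prod.
Qed.

(** The determinant is congruent to 1 modulo [m] and homogeneous of degree 0, so it is a unit, and
    the adjugate gives the inverse. Homogeneity matters in the graded case, where an element of
    [1 + m] can fail to be a unit. *)
Lemma invertible_mod_m n (e : 'I_n -> int) (A : 'M[R]_n) :
  (forall i j, hpart H (e i - e j) (A i j)) ->
  (forall i j, m (A i j - (1%:M : 'M_n) i j)) ->
  exists2 B : 'M[R]_n, A *m B = 1%:M & B *m A = 1%:M.
Proof.
move=> /hpart_det/hpart_unit detA /det_congr; rewrite det1 => mA.
case: detA => [mdet|[y dety]].
  case: (m_proper H); rewrite -(subKr (\det A) 1).
  by apply: (mD H) => //; apply: (mN H).
exists (y *: \adj A).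
  by rewrite -scalemxAr mul_mx_adj scale_scalar_mx mulrC dety.
by rewrite -scalemxAl mul_adj_mx scale_scalar_mx mulrC dety.
Qed.

Lemma kernel_lift (F : free_complex R) I n p (M : 'M_(p, rank F n.+1)) :
  resolution F I -> M *m diff F n = 0 ->
  exists N : 'M_(p, rank F n.+2), M = N *m diff F n.+1.
Proof.
move=> [_ exF] Md0.
have /choice[w hw] i : exists w, row i M = w *m diff F n.+1.
  by apply/exF; rewrite -row_mul Md0 row0.
exists (\matrix_i w i); apply/row_matrixP => i.
by rewrite row_mul rowK.
Qed.

(** Each entry of a given factor [N] is replaced by its part in the expected degree; as [M] and [D]
    are homogeneous, this does not change the product. *)
Lemma homogeneous_factor p q r (a : 'I_p -> int) (b : 'I_q -> int)
    (c : 'I_r -> int) (M : 'M[R]_(p, r)) N (D : 'M[R]_(q, r)) :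
  (forall i j, hpart H (a i - c j) (M i j)) ->
  (forall i j, hpart H (b i - c j) (D i j)) -> M = N *m D ->
  exists2 N' : 'M[R]_(p, q),
    forall i j, hpart H (a i - b j) (N' i j) & M = N' *m D.
Proof.
move=> hM hD MND; exists (\matrix_(i, j) pr H (a i - b j) (N i j)).
  by move=> i j; rewrite mxE; apply: hpart_pr.
apply/matrixP => i j; rewrite -(pr_id (hM i j)) MND !mxE pr_sum.
apply: eq_bigr => k _; rewrite mxE -(prM _ _ (hD k j)).
by rewrite addrA subrK.
Qed.

Definition homogeneous_complex (F : free_complex R)
    (e : forall n, 'I_(rank F n) -> int) : Prop :=
  (forall i, e 0%N i = 0) /\
  (forall n i j, hpart H (e n.+1 i - e n j) (diff F n i j)).

Lemma diff_diff (F : free_complex R) I n :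
  resolution F I -> diff F n.+1 *m diff F n = 0.
Proof.
move=> [_ exF]; apply/row_matrixP => i; rewrite row_mul row0.
by apply/exF; exists (delta_mx 0 i); rewrite rowE.
Qed.

Lemma comparison (F F' : free_complex R) I
    (e : forall n, 'I_(rank F n) -> int)
    (e' : forall n, 'I_(rank F' n) -> int) :
  resolution F I -> resolution F' I ->
  homogeneous_complex e -> homogeneous_complex e' ->
  exists a : forall n, 'M[R]_(rank F n, rank F' n),
    [/\ a 0%N = 1%:M,
        forall n i j, hpart H (e n i - e' n j) (a n i j) &
        forall n, diff F n *m a n = a n.+1 *m diff F' n].
Proof.
move=> resF resF' [e0 he] [e'0 he'].
(* The factorization needed for the next step belongs to the invariant because its origin varies: in
   degree 0 both complexes resolve the same quotient, in higher degrees [F'] is exact. *)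
pose Q n (x : 'M[R]_(rank F n, rank F' n)) :=
  (forall i j, hpart H (e n i - e' n j) (x i j)) /\
  exists N, diff F n *m x = N *m diff F' n.
pose S n (x : 'M[R]_(rank F n, rank F' n)) y :=
  diff F n *m x = y *m diff F' n.
have Q0 : Q 0%N (1%:M : 'M_1).
  split=> [i j|].
    rewrite e0 e'0 subrr mxE; case: eqP => _; [exact: hpart1|exact: hpart0].
  case: resF resF' => [IF _] [IF' _].
  have /choice[w hw] i : exists w, row i (diff F 0) = w *m diff F' 0.
    have [w hw] : exists v, v *m diff F' 0 = (diff F 0 i 0)%:M :> 'rV_1.
      apply/IF'/IF; exists (delta_mx 0 i).
      by rewrite -rowE [LHS]mx11_scalar mxE.
    by exists w; rewrite hw [LHS]mx11_scalar mxE.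
  exists (\matrix_i w i); apply/row_matrixP => i.
  by rewrite mulmx1 row_mul rowK hw.
have step n x : Q n x -> exists2 y, Q n.+1 y & S n x y.
  move=> [hx [N xN]].
  have hdx i j : hpart H (e n.+1 i - e' n j) ((diff F n *m x) i j).
    rewrite mxE; apply: (big_ind (hpart H _)) => [||k _].
    - exact: hpart0.
    - exact: hpartD.
    - by rewrite -(subrK (e n k) (e n.+1 i)) -addrA; apply: hpartM.
  have [y hy xy] := homogeneous_factor hdx (he' n) xN.
  exists y => //; split=> //; apply: (kernel_lift resF').
  by rewrite -mulmxA -xy mulmxA (diff_diff _ resF) mul0mx.
have [a [a0 ha]] := dependent_choice_seq Q0 step.
by exists a; split=> // n; case: (ha n) => -[].
Qed.

(** [g - 1] is a chain map vanishing in degree 0, hence null-homotopic. Writing it as [d s + s d],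
    every entry lies in [m] because the entries of [d] do. *)
Lemma homotopic_to_id (F : free_complex R) I
    (g : forall n, 'M[R]_(rank F n)) n i j :
  resolution F I -> minimal m F -> g 0%N = 1%:M ->
  (forall n, diff F n *m g n = g n.+1 *m diff F n) ->
  m (g n i j - (1%:M : 'M_(rank F n)) i j).
Proof.
move=> resF minF g0 gd.
have m_mul p q r (A : 'M[R]_(p, q)) (B : 'M[R]_(q, r)) i' j' :
    (forall i j, m (A i j)) \/ (forall i j, m (B i j)) ->
    m ((A *m B) i' j').
  move=> mAB; rewrite mxE; apply: big_ind; [exact: (m0 H)|exact: (mD H)|].
  by move=> k _; case: mAB => ?; [apply: (mMl H)|apply: (mM H)].
pose del n : 'M[R]_(rank F n) := g n - 1%:M.
have deld k : diff F k *m del k = del k.+1 *m diff F k.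
  by rewrite mulmxBr mulmxBl gd mulmx1 mul1mx.
pose Q n (s : 'M[R]_(rank F n, rank F n.+1)) :=
  diff F n *m (del n - s *m diff F n) = 0.
pose S n (s : 'M[R]_(rank F n, rank F n.+1)) s' :=
  del n.+1 = diff F n *m s + s' *m diff F n.+1.
have Q0 : Q 0%N 0 by rewrite /Q /del g0 subrr mul0mx subr0 mulmx0.
have step k x : Q k x -> exists2 y, Q k.+1 y & S k x y.
  move=> Qx.
  have [y hy] : exists y, del k.+1 - diff F k *m x = y *m diff F k.+1.
    apply: (kernel_lift resF); rewrite mulmxBl -deld -mulmxA -mulmxBr.
    exact: Qx.
  exists y; last by rewrite /S -hy subrKC.
  by rewrite /Q -hy subKr mulmxA (diff_diff _ resF) mul0mx.
have [s [_ hs]] := dependent_choice_seq Q0 step.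
case: n i j => [|n] i j.
  by rewrite g0 subrr; apply: (m0 H).
have -> : g n.+1 i j - (1%:M : 'M_(rank F n.+1)) i j = del n.+1 i j.
  by rewrite /del !mxE.
have [_ ->] := hs n; rewrite mxE; apply: (mD H); apply: m_mul.
  by left; apply: minF.
by right; apply: minF.
Qed.

(** Both composites of the comparison maps are invertible, being homogeneous and congruent to 1
    modulo [m]. So [a n] has a right and a left inverse, which must coincide; this common inverse,
    not the comparison map going back, is the [b] of the statement. *)
Theorem minimal_resolution_unique (F F' : free_complex R) I
    (e : forall n, 'I_(rank F n) -> int)
    (e' : forall n, 'I_(rank F' n) -> int) :
  minimal_free_resolution m F I -> minimal_free_resolution m F' I ->
  homogeneous_complex e -> homogeneous_complex e' ->
  exists (a : forall n, 'M[R]_(rank F n, rank F' n))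
         (b : forall n, 'M[R]_(rank F' n, rank F n)),
    [/\ a 0%N = 1%:M, forall n, diff F n *m a n = a n.+1 *m diff F' n,
        forall n, a n *m b n = 1%:M & forall n, b n *m a n = 1%:M].
Proof.
move=> [resF minF] [resF' minF'] he he'.
have [a [a0 ha da]] := comparison resF resF' he he'.
have [b [b0 hb db]] := comparison resF' resF he' he.
have homM p q r (x : 'I_p -> int) (y : 'I_q -> int) (z : 'I_r -> int)
    (A : 'M[R]_(p, q)) (B : 'M[R]_(q, r)) i j :
    (forall i j, hpart H (x i - y j) (A i j)) ->
    (forall i j, hpart H (y i - z j) (B i j)) ->
    hpart H (x i - z j) ((A *m B) i j).
  move=> hA hB; rewrite mxE; apply: (big_ind (hpart H _)) => [||k _].
  - exact: hpart0.
  - exact: hpartD.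
  - by rewrite -(subrK (y k) (x i)) -addrA; apply: hpartM.
have inv (C D : free_complex R) eC eD (u : forall n, 'M[R]_(rank C n, rank D n))
    (v : forall n, 'M[R]_(rank D n, rank C n)) n :
    resolution C I -> minimal m C -> u 0%N = 1%:M -> v 0%N = 1%:M ->
    (forall n i j, hpart H (eC n i - eD n j) (u n i j)) ->
    (forall n i j, hpart H (eD n i - eC n j) (v n i j)) ->
    (forall n, diff C n *m u n = u n.+1 *m diff D n) ->
    (forall n, diff D n *m v n = v n.+1 *m diff C n) ->
  exists2 B, u n *m v n *m B = 1%:M & B *m (u n *m v n) = 1%:M.
  move=> resC minC u0 v0 hu hv du dv.
  apply: (@invertible_mod_m _ (eC n)) => i j; first exact: homM.
  apply: (@homotopic_to_id C I (fun n => u n *m v n)) => //.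
    by rewrite u0 v0 mulmx1.
  by move=> k; rewrite mulmxA du -mulmxA dv mulmxA.
have inverse n : exists b' : 'M[R]_(rank F' n, rank F n),
    a n *m b' = 1%:M /\ b' *m a n = 1%:M.
  have [B aB _] := inv _ _ _ _ _ _ n resF minF a0 b0 ha hb da db.
  have [C _ Ca] := inv _ _ _ _ _ _ n resF' minF' b0 a0 hb ha db da.
  exists (b n *m B); split; first by rewrite mulmxA.
  have -> : b n *m B = C *m b n.
    by rewrite -[LHS]mul1mx -Ca -!mulmxA (mulmxA (a n)) aB mulmx1.
  by rewrite -mulmxA.
exists a, (fun n => sval (cid (inverse n))); split=> // n;
  by case: (svalP (cid (inverse n))).
Qed.
End Uniqueness.

(** * From a dg subalgebra with bases to a product on a complex *)

Section FramedStructure.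
Variables (R : comNzRingType) (T : cdga R) (P : nat -> T -> Prop).
Variables (F : free_complex R).
Variables (g : forall n, 'rV[R]_(rank F n) -> T).
Variables (h : forall n, T -> 'rV[R]_(rank F n)).

Hypothesis g_linear : forall n, linear (g (n := n)).
Hypothesis h_linear : forall n, linear (h n).
Hypothesis gK : forall n v, h n (g v) = v.
Hypothesis gP : forall n (v : 'rV_(rank F n)), P n (g v).
Hypothesis hK : forall n x, P n x -> g (h n x) = x.
Hypothesis P_deg : forall n x, P n x -> deg n x.
Hypothesis P_mul : forall i j (x y : T),
  P i x -> P j y -> P (i + j)%N (mul x y).
Hypothesis g_one : g (1%:M : 'rV_(rank F 0)) = one T.
Hypothesis df_g : forall n (v : 'rV_(rank F n.+1)),
  df (g v) = g (v *m diff F n).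

Lemma linear_cstr0 (V W : lmodType R) (a : V -> W) : linear a -> a 0 = 0.
Proof.
move=> aL; apply: (addrI (a 0)); rewrite addr0.
by have := aL 1 0 0; rewrite !scale1r addr0.
Qed.

Lemma linear_cstrZ (V W : lmodType R) (a : V -> W) r v :
  linear a -> a (r *: v) = r *: a v.
Proof.
by move=> aL; have := aL r v 0; rewrite (linear_cstr0 aL) !addr0.
Qed.

Lemma linear_cstrD (V W : lmodType R) (a : V -> W) u v :
  linear a -> a (u + v) = a u + a v.
Proof. by move=> aL; have := aL 1 u v; rewrite !scale1r. Qed.

Definition frame_mul i j n (x : 'rV_(rank F i)) (y : 'rV_(rank F j)) :
    'rV[R]_(rank F n) :=
  if n == (i + j)%N then h n (mul (g x) (g y)) else 0.

Lemma df_gE n (v : 'rV_(rank F n)) : df (g v) = g (bd v).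
Proof.
case: n v => [|n] v /=; last exact: df_g.
by rewrite (linear_cstr0 (@g_linear 0)) df_deg0 //; apply/P_deg/gP.
Qed.

Lemma bd_h n x : P n x -> bd (h n x) = h n.-1 (df x).
Proof. by move=> Px; rewrite -[in RHS](hK Px) df_gE gK. Qed.

Lemma frame_dg_algebra : dg_algebra frame_mul.
Proof.
split=> [i j n x y|i j n y|i j n x|i j k p q n x y z -> -> ->|i x|i x|].
- by rewrite /frame_mul => /negPf->.
- move=> r u v; rewrite /frame_mul; case: eqP => _.
    by rewrite g_linear mulDl mulZl h_linear.
  by rewrite scaler0 addr0.
- move=> r u v; rewrite /frame_mul; case: eqP => _.
    by rewrite g_linear mulDr mulZr h_linear.
  by rewrite scaler0 addr0.
- rewrite /frame_mul !eqxx addnA eqxx !hK ?mulA //; exact: P_mul.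
- by rewrite /frame_mul eqxx g_one mul1x gK.
- by rewrite /frame_mul addn0 eqxx g_one mulx1 gK.
move=> i j _ x y ->; rewrite {1}/frame_mul eqxx bd_h; last exact: P_mul.
rewrite dfM (deg_cj (P_deg (gP x))) mulZl (linear_cstrD _ _ (@h_linear _)).
rewrite (linear_cstrZ _ _ (@h_linear _)) !df_gE; congr (_ + _ *: _).
  (* For [i = 0] the predecessor [i.-1] is again 0, so the degrees add up only when [j = 0]; either
     way the summand is 0, since [bd x = 0]. *)
  rewrite /frame_mul; case: i x => [|i] x /=; last by rewrite eqxx.
  rewrite (linear_cstr0 (@g_linear 0)) mul0x (linear_cstr0 (@h_linear _)).
  by case: eqP => // <-; rewrite (linear_cstr0 (@h_linear _)).
rewrite /frame_mul; case: j y => [|j] y /=; last by rewrite addnS eqxx.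
rewrite (linear_cstr0 (@g_linear 0)) mulx0 (linear_cstr0 (@h_linear _)).
by case: eqP => // <-; rewrite (linear_cstr0 (@h_linear _)).
Qed.

Lemma frame_strictly_commutative : strictly_commutative frame_mul.
Proof.
split=> [i j _ x y ->|i _ x oi ->]; rewrite /frame_mul eqxx; last first.
  by rewrite (mulxx oi (P_deg (gP x))) (linear_cstr0 (@h_linear _)).
rewrite addnC eqxx (mulC _ (P_deg (gP x))) -(linear_cstrZ _ _ (@h_linear _)).
rewrite -mulZl; congr (h _ (mul _ _)); rewrite mulnC exprM.
have gy := deg_cj (P_deg (gP y)).
elim: i {x} => [|i IH] /=; first by rewrite expr0 scale1r.
by rewrite IH cjZ gy scalerA exprSr.
Qed.

Lemma frame_has_strict_cdga_structure : has_strict_cdga_structure F.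
Proof.
exists frame_mul; split; first exact: frame_dg_algebra.
exact: frame_strictly_commutative.
Qed.

End FramedStructure.

(** * The minimal resolution of R/(C + fL) *)

Section KoszulMapHom.
Variables (R : comNzRingType) (m : set R) (H : homog_setting m).
Variables (dg : R -> int) (ls : seq R) (z : R -> koszul ls).

Lemma kmap_hom s w (x : koszul s) :
    graded_seq H dg s -> (forall c, c \in s -> hom H dg (dg c) (z c)) ->
  hom H dg w x -> hom H dg w (kmap z x).
Proof.
elim: s w x => [|c s IH] w x /=.
  by move=> _ _ hx; rewrite -[w]addr0; apply: homZ => //; apply: hom_one.
move=> /graded_seq_cons[hc hs] hz [x1 x2].
have hz' d : d \in s -> hom H dg (dg d) (z d).
  by move=> ds; apply: hz; rewrite inE ds orbT.
apply: homD; first exact: IH.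
by rewrite -(subrKC (dg c) w); apply: homM; [apply/hz/mem_head | apply: IH].
Qed.

(** In positive degree every monomial contains a generator, so its image contains some [z c]. *)
Lemma kmap_coef_m s n (x : koszul s) :
    (forall c, c \in s -> coef_m m (z c)) ->
  deg n.+1 x -> coef_m m (kmap z x).
Proof.
elim: s x => [|c s IH] x /=.
  by move=> _ ->; rewrite scale0r; apply: (coef_m0 H).
move=> hz [x1 x2]; apply: (coef_mD H).
  by apply: IH => // d ds; apply: hz; rewrite inE ds orbT.
by apply/(coef_mM H)/hz/mem_head.
Qed.

End KoszulMapHom.

Section Resolution.
Variables (R : comNzRingType) (m : set R) (H : homog_setting m).
Variables (dg : R -> int) (f : R) (cs ls : seq R) (z : R -> koszul ls).

Hypothesis f_reg : GRing.lreg f.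
Hypothesis hf : hpart H (dg f) f.
Hypothesis hcs : graded_seq H dg cs.
Hypothesis hls : graded_seq H dg ls.
Hypothesis m_cs : forall c, c \in cs -> m c.
Hypothesis m_ls : forall c, c \in ls -> m c.
Hypothesis m_f : m f \/ cs = [::].
Hypothesis acyclicE : acyclic (koszul (f :: cs)).
Hypothesis acyclicL : acyclic (koszul ls).
Hypothesis z_lift : koszul_lift z cs.
Hypothesis z_hom : forall c, c \in cs -> hom H dg (dg c) (z c).
Hypothesis z_m : forall c, c \in cs -> coef_m m (z c).

Let E := koszul (f :: cs).
Let L := koszul ls.

(** The extension of phi to E that sends [t] to 0. Since [dt = f], it is a chain map only modulo
    [f], and [res_xi], phi of the coefficient of [t], is the defect. *)
Definition res_psi (u : E) : L := kmap z u.1.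
Definition res_xi (u : E) : L := kmap z u.2.

Definition res_cdga : cdga R.
Proof.
apply: (@glue R E L f res_psi res_xi); rewrite /res_psi /res_xi.
- exact: koszul_torsion_free.
- by move=> u v; rewrite kmapD.
- by move=> r u; rewrite kmapZ.
- by move=> u v; rewrite kmapM.
- exact: kmap_one.
- by move=> u; rewrite kmap_cj.
- by move=> n u [u1 _]; apply: kmap_deg.
- by move=> u; rewrite kmapD kmapZ kmap_df.
- by move=> n u [_ u2]; apply: kmap_deg.
Defined.

(* R in degree 0; in degree 1 the coefficient of t is determined by the
   component in L, so that the differential lands in R. *)
Definition res_part n (x : res_cdga) : Prop :=
  match n with
  | 0 => deg 0 x /\ x.2 = 0
  | 1 => deg 1 x /\ x.1.2 = aug (df (x.2 : L)) *: one (koszul cs)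
  | _ => deg n x
  end.

Lemma res_part_deg n x : res_part n x -> deg n x.
Proof. by case: n => [|[|n]] => [[]|[]|]. Qed.

Lemma res_part0 x : res_part 0 x -> x = aug x.1 *: one res_cdga.
Proof.
move=> [[x1 _] x2]; apply: pair_eqP; last by rewrite /= x2 scaler0.
exact: (aug_deg0 x1).
Qed.

Lemma res_partZ n r x : res_part n x -> res_part n (r *: x).
Proof.
move=> Px; have := degZ r (res_part_deg Px).
case: n Px => [|[|n]] Px //; split=> //.
  by case: Px => _ /= ->; rewrite scaler0.
by case: Px => _ /= ->; rewrite dfZ augZ scalerA.
Qed.

(** Two low degrees need an argument. From degree 1, the condition on the coefficient of [t] says
    precisely that [df x.2 - res_xi x.1] vanishes. From degree 2, with [u] the coefficient of [t],
    the condition on [df x] compares [- df u] with [- df (phi u)]; they are the same scalar, because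
    phi is a chain map and the identity on R. *)
Lemma res_part_df n x : res_part n.+1 x -> res_part n (df x).
Proof.
case: n => [|[|n]] x1; have dx := deg_df (res_part_deg x1).
- split=> //; case: x1 => [[_ /= y1] e]; rewrite /res_xi e kmapZ kmap_one.
  by rewrite [df x.2]aug_deg0 ?augZ ?aug_one ?mulr1 ?subrr //; apply: deg_df.
- split=> //; case: x1 => [[/= _ u1] y2].
  rewrite dfD dfK add0r dfN -kmap_df //.
  by rewrite [df x.1.2](aug_deg0 (deg_df u1)) kmapZ kmap_one -scaleNr augZ
    aug_one mulr1 scaleNr.
- exact: dx.
Qed.

(** A product of two elements of positive degree lands in degree at least 2, where nothing is
    imposed; the remaining factors are scalars. *)
Lemma res_part_mul i j x y :
  res_part i x -> res_part j y -> res_part (i + j)%N (mul x y).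
Proof.
case: i => [|i] xi.
  by move=> yj; rewrite (res_part0 xi) mulZl mul1x; apply: res_partZ.
case: j => [|j] yj.
  by rewrite (res_part0 yj) mulZr mulx1 addn0; apply: res_partZ.
have := degM (res_part_deg xi) (res_part_deg yj).
by rewrite addSn addnS.
Qed.

(** Exactness of an extension: [x.1] bounds some [u] in E, then [x.2 + res_xi u] is a cycle of K(l)
    and bounds [y]. The pair [(u, y)] has degree at least 2, so it lies in the subalgebra
    automatically. *)
Lemma res_part_exact n x : res_part n.+1 x -> df x = 0 ->
  exists2 y, res_part n.+2 y & df y = x.
Proof.
move=> Px dx; have [x1 x2] := res_part_deg Px.
have dx1 := congr1 fst dx; have dx2 := congr1 snd dx.
have [u u1 du] := acyclicE x1 dx1.
have [y y1 dy] : exists2 y : L, deg n.+2 y & df y = x.2 + res_xi u.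
  apply: acyclicL.
    by apply: degD => //; apply: kmap_deg => //; case: u1.
  rewrite dfD -kmap_df //; have /= -> : df u.2 = - x.1.2.
    by rewrite -(congr1 snd du) /= opprK.
  by rewrite kmapN.
exists (u, y); first by [].
by apply: pair_eqP => //=; rewrite dy addrK.
Qed.

(** The shift by [dg f] is there because [x.2] stands for [f *: x.2] in the fibre product. *)
Definition res_hom w (x : res_cdga) : Prop :=
  hom H dg w x.1 /\ hom H dg (w - dg f) x.2.
Definition res_coef_m (x : res_cdga) : Prop :=
  coef_m m x.1 /\ coef_m m x.2.

Lemma graded_seq_adjoined : graded_seq H dg (f :: cs).
Proof.
by move=> c; rewrite inE => /orP[/eqP->|/hcs].
Qed.

Lemma res_hom_df w x : res_hom w x -> res_hom w (df x).
Proof.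
move=> [x1 x2]; split; first exact: (hom_df graded_seq_adjoined).
apply: homD; first exact: hom_df.
by apply/homN/kmap_hom => //; case: x1.
Qed.

(** Two entries threaten minimality: [f], if it is a unit, and the constant [res_xi t = 1]. In
    degree 1, [f] is multiplied by [aug (df x.2)], which lies in [m], and the [res_xi] term cancels
    by the choice of the subalgebra. In higher degree the coefficient of [t] has positive degree:
    phi then takes it into [m], and either [f] is in [m] or the coefficient is 0 because [cs] is
    empty. *)
Lemma res_coef_m_df n x : res_part n.+1 x -> res_coef_m (df x).
Proof.
move=> Px; have [[_ x12] x2] := res_part_deg Px.
have dm s (y : koszul s) : (forall c, c \in s -> m c) -> coef_m m (df y).
  exact: (coef_m_df H).
split=> /=.
  split; last exact/(coef_mN H)/dm.
  apply: (coef_mD H); first exact: dm.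
  case: n Px x12 x2 => [[_ ->] _ _|n _ x12 _].
    apply/(coef_mZ H)/(coef_mZl H); apply: coef_m_aug; exact: dm.
  case: m_f => [mf|cs0]; first exact: (coef_mZl H _ mf).
  have nil0 (s : seq R) (y : koszul s) : s = [::] -> deg n.+1 y -> y = 0.
    by case: s y.
  by rewrite (nil0 _ _ cs0 x12) scaler0; apply: (coef_m0 H).
case: n Px x12 x2 => [Px _ _|n _ x12 _].
  by have [_ /= ->] := res_part_df Px; apply: (coef_m0 H).
apply: (coef_mD H); first exact: dm.
exact/(coef_mN H)/(kmap_coef_m H z_m x12).
Qed.

Definition res_frame0 : frame H (res_part 0) res_hom res_coef_m 1.
Proof.
apply: (@Frame _ _ _ res_cdga _ _ _ 1 (fun=> 0)
  (fun v : 'rV[R]_1 => v 0 0 *: one res_cdga)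
  (fun x => (aug x.1)%:M)).
- by move=> r u v; rewrite !mxE scalerDl scalerA.
- by move=> r u v; rewrite augD augZ raddfD /= -scale_scalar_mx.
- by move=> v; rewrite augZ (aug_one (f :: cs)) mulr1 -mx11_scalar.
- move=> v; apply: res_partZ; split=> //; exact: deg_one.
- by move=> x Px; rewrite mxE mulr1n -(res_part0 Px).
- move=> w v /(_ 0); rewrite subr0 => hv; split.
    rewrite -[w]addr0; apply: homZ => //; exact: (hom_one H dg (f :: cs)).
  by rewrite /= scaler0; apply: hom0.
- by move=> w x i _ [hx _]; rewrite ord1 mxE subr0; apply: hom_aug hx.
- by move=> x i [mx _]; rewrite ord1 mxE; apply: coef_m_aug mx.
Defined.

(** The degree 1 part is the graph of a linear map from the sum of K(c)_1 and K(l)_1 to the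
    multiples of [t], so a basis of that sum can be transported. *)
Lemma res_frame1 : {r & frame H (res_part 1) res_hom res_coef_m r}.
Proof.
have [r1 F1] := koszul_frame H dg cs 1; have [r2 F2] := koszul_frame H dg ls 1.
exists (r1 + r2)%N.
apply: (@frame_transport R m H (koszul cs * koszul ls)%type res_cdga _ _ _ _ _ _
  (r1 + r2) (fun u => ((u.1, aug (df u.2) *: one (koszul cs)), u.2))
  (fun x => (x.1.1, x.2)) _ _ _ _ _ _ _ _ _ (frame_sum (dg f) F1 F2)).
- move=> r u v; apply: pair_eqP => //; apply: pair_eqP => //=.
  by rewrite dfD dfZ augD augZ scalerDl scalerA.
- by move=> r u v; apply: pair_eqP.
- by move=> [].
- move=> u [u1 u2]; split=> //; split=> //; split=> //=.
  by apply: degZ; apply: deg_one.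
- by move=> x [[[x1 _] x2] _].
- by move=> x [_ x12]; apply: pair_eqP => //; apply: pair_eqP.
- move=> w u _ [u1 u2]; split=> //; split=> //=.
  rewrite -[w - _]addr0; apply: homZ; last exact: hom_one.
  by apply: (hom_aug (dg := dg)); apply: hom_df.
- by move=> w x _ [[x1 _] x2].
- by move=> x [[x1 _] x2].
Qed.

Lemma res_frame2 n : {r & frame H (res_part n.+2) res_hom res_coef_m r}.
Proof.
have [r1 F1] := koszul_frame H dg (f :: cs) n.+2.
have [r2 F2] := koszul_frame H dg ls n.+2.
exists (r1 + r2)%N; exact: (frame_sum (dg f) F1 F2).
Qed.

Definition res_rank n : nat :=
  if n is n'.+1 then projT1 (res_frame2 n') else projT1 res_frame1.

(** The size is spelled out so as to be convertible to [rank res_complex n], whose complex is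
    defined from these frames. *)
Definition res_frame n :
  frame H (res_part n) res_hom res_coef_m
    (if n is n'.+1 then res_rank n' else 1%N) :=
  match n with
  | 0 => res_frame0
  | 1 => projT2 res_frame1
  | n'.+2 => projT2 (res_frame2 n')
  end.

Definition res_complex : free_complex R :=
  @FreeComplex R res_rank (fun n => \matrix_(i, j)
    fh (res_frame n) (df (fg (res_frame n.+1) (delta_mx 0 i))) 0 j).

Lemma mul_matrix_of p q (a : 'rV[R]_p -> 'rV[R]_q) v :
  linear a -> v *m (\matrix_(i, j) a (delta_mx 0 i) 0 j) = a v.
Proof.
move=> aL; rewrite [in RHS](row_sum_delta v).
have aS : a (\sum_j v 0 j *: delta_mx 0 j) = \sum_j v 0 j *: a (delta_mx 0 j).
  rewrite (big_morph a (fun x y => linear_cstrD x y aL) (linear_cstr0 aL)).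
  by apply: eq_bigr => j _; apply: linear_cstrZ.
rewrite aS; apply/rowP => j; rewrite mxE summxE.
by apply: eq_bigr => i _; rewrite !mxE.
Qed.

Lemma res_diffE n (v : 'rV[R]_(rank res_complex n.+1)) :
  v *m diff res_complex n = fh (res_frame n) (df (fg (res_frame n.+1) v)).
Proof.
rewrite (mul_matrix_of
  (a := fun v => fh (res_frame n) (df (fg (res_frame n.+1) v)))) //.
by move=> r u w; rewrite fg_linear dfD dfZ fh_linear.
Qed.

Lemma res_df_fg n (v : 'rV[R]_(rank res_complex n.+1)) :
  df (fg (res_frame n.+1) v) = fg (res_frame n) (v *m diff res_complex n).
Proof. by rewrite res_diffE fhK //; apply: res_part_df; apply: fgP. Qed.

Lemma res_resolution :
  resolution res_complex (ideal_add_scale (ideal_gen cs) f (ideal_gen ls)).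
Proof.
split=> [a|n v].
  split=> [[c [l [/koszul_boundary0[k k1 dk] /koszul_boundary0[y y1 dy] ->]]]|].
    (* With [df k = c] and [df y = l], the coefficient [l] of [t] yields the differential
       [c + f * l] and cancels its component in K(l). *)
    pose x : res_cdga := ((k, l *: one (koszul cs)), y).
    have Px : res_part 1 x.
      split; last by rewrite /= dy augZ aug_one mulr1.
      by split=> //; split=> //=; apply: degZ; apply: deg_one.
    exists (fh (res_frame 1) x); rewrite res_diffE fhK //.
    congr (_%:M); rewrite /= dk augD !augZ aug_one !mulr1 //.
  move=> [v]; rewrite res_diffE => /matrixP/(_ 0 0); rewrite !mxE !mulr1n.
  have [[/= [k1 _] y1] e] := fgP (res_frame 1) v.
  set x := fg _ _ in k1 y1 e *; rewrite /= e => <-.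
  exists (aug (df x.1.1)), (aug (df x.2)); rewrite augD !augZ aug_one mulr1.
  split=> //; apply/koszul_boundary0.
    by exists x.1.1 => //; rewrite -aug_deg0 //; apply: deg_df.
  by exists x.2 => //; rewrite -aug_deg0 //; apply: deg_df.
have g0 k : fg (res_frame k) 0 = 0 by apply: linear_cstr0; apply: fg_linear.
split=> [dv|[w ->]].
  have [y Py dy] := res_part_exact (fgP (res_frame n.+1) v)
    (etrans (res_df_fg v) (etrans (congr1 _ dv) (g0 n))).
  exists (fh (res_frame n.+2) y); rewrite res_diffE fhK //.
  by rewrite dy fgK.
rewrite !res_diffE fhK; last by apply: res_part_df; apply: fgP.
by rewrite dfK (linear_cstr0 (fh_linear _)).
Qed.

Lemma res_minimal : minimal m res_complex.
Proof.
move=> n i j; rewrite mxE; apply: fh_m.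
by apply: (res_coef_m_df (n := n)); apply: (fgP (res_frame n.+1)).
Qed.

Lemma res_homogeneous : exists e, homogeneous_complex H (F := res_complex) e.
Proof.
exists (fun n => fe (res_frame n)); split=> // n i j.
rewrite mxE; apply: fh_hom; first by apply: res_part_df; apply: fgP.
apply: res_hom_df; apply: fg_hom => k; rewrite mxE /=.
by case: eqP => [->|_]; [rewrite subrr; apply: hpart1 | apply: hpart0].
Qed.

Lemma minimal_resolution_cdga (F : free_complex R) e :
    minimal_free_resolution m F
      (ideal_add_scale (ideal_gen cs) f (ideal_gen ls)) ->
    homogeneous_complex H (F := F) e ->
  has_strict_cdga_structure F.
Proof.
move=> minF he; have [e0 he0] := res_homogeneous.
have [a [b [a0 da ab ba]]] := minimal_resolution_unique
  (conj res_resolution res_minimal) minF he0 he.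
have b0 : b 0%N = 1%:M by have := ab 0%N; rewrite a0 mul1mx.
have db n : diff F n *m b n = b n.+1 *m diff res_complex n.
  rewrite -[LHS]mul1mx -(ba n.+1) -!mulmxA (mulmxA (a n.+1)) -da.
  by rewrite -!mulmxA ab mulmx1.
apply: (@frame_has_strict_cdga_structure R res_cdga res_part F
  (fun n v => fg (res_frame n) (v *m b n))
  (fun n x => fh (res_frame n) x *m a n)).
- by move=> n r u v; rewrite mulmxDl -scalemxAl fg_linear.
- by move=> n r u v; rewrite fh_linear mulmxDl -scalemxAl.
- by move=> n v; rewrite fgK -mulmxA ba mulmx1.
- by move=> n v; apply: fgP.
- by move=> n x Px; rewrite -mulmxA ab mulmx1 fhK.
- exact: res_part_deg.
- exact: res_part_mul.
- by rewrite b0 mulmx1 /= mxE scale1r.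
- by move=> n v; rewrite res_df_fg -!mulmxA db.
Qed.

End Resolution.

(** * Lifting generators of C to the Koszul algebra of L *)

Section CompleteIntersections.
Variables (R : comNzRingType) (m : set R) (H : homog_setting m).

Lemma koszul_generator (dg : R -> int) s c : graded_seq H dg s -> c \in s ->
  exists2 y : koszul s, deg 1 y /\ hom H dg (dg c) y & df y = c *: one _.
Proof.
elim: s => // d s IH /graded_seq_cons[hd hs]; rewrite inE.
have [-> _|_ /= /(IH hs)[y [y1 hy] dy]] := eqVneq c d.
  exists ((0, one _) : koszul (d :: s)).
    split; split=> /=; rewrite ?subrr.
    - exact: deg0.
    - exact: deg_one.
    - exact: hom0.
    - exact: hom_one.
  by apply: pair_eqP; rewrite /= ?df0 ?add0r // df_one scaler0 oppr0.
exists ((y, 0) : koszul (d :: s)).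
  by split; split=> //=; [apply: deg0 | apply: hom0].
by apply: pair_eqP; rewrite /= ?scaler0 ?addr0 // df0 oppr0.
Qed.

(** Each summand [a * c], with [a] in [m] and [c] a generator, lifts to the part of [a] of degree
    [w - dg c] times the generator over [c]. The summands of [x] need not be homogeneous, which is
    why [pr H w x] is lifted: this formulation is additive in [x]. *)
Lemma koszul_lift_mul (dg : R -> int) s x w :
    graded_seq H dg s -> ideal_mul m (ideal_gen s) x ->
  exists y : koszul s,
    [/\ deg 1 y, coef_m m y, hom H dg w y & df y = pr H w x *: one _].
Proof.
move=> hs.
pose lifts x := exists y : koszul s,
    [/\ deg 1 y, coef_m m y, hom H dg w y & df y = pr H w x *: one _].
have lifts0 : lifts 0.
  exists 0; split; [exact: deg0|exact: coef_m0|exact: hom0|].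
  by rewrite df0 pr0 scale0r.
have liftsD u v : lifts u -> lifts v -> lifts (u + v).
  move=> [y [y1 my hy dy]] [y' [y1' my' hy' dy']]; exists (y + y').
  split; [exact: degD|exact: coef_mD|exact: homD|].
  by rewrite dfD dy dy' prD scalerDl.
have lifts_gen b : ideal_gen s b -> forall a, m a -> lifts (a * b).
  apply: (@ideal_gen_min _ s [set b | forall a, m a -> lifts (a * b)]).
    split=> [a _|r u v hu hv a ma]; first by rewrite mulr0.
    rewrite mulrDr mulrA; apply: liftsD; last exact: hv.
    by apply: hu; apply: (mMl H).
  move=> c cs a ma; have [y [y1 hy] dy] := koszul_generator hs cs.
  exists (pr H (w - dg c) a *: y); split.
  - exact: degZ.
  - by apply: (coef_mZl H); apply: pr_m.
  - by have := homZ (hpart_pr H (w - dg c) a) hy; rewrite subrK.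
  - by rewrite dfZ dy scalerA -(prM _ _ (hs c cs)) subrK.
move=> [n [a [b [ma Lb ->]]]].
by apply: (big_ind lifts) => // i _; exact: (lifts_gen _ (Lb i) _ (ma i)).
Qed.

Lemma complete_intersection_cdga (c l : seq R) (f : R) (zf : int)
    (F : free_complex R) (e : forall n, 'I_(rank F n) -> int) :
    regular_sequence c -> regular_sequence l ->
    (forall x, x \in c -> exists z, hpart H z x) ->
    (forall x, x \in l -> exists z, hpart H z x) ->
    hpart H zf f ->
    ideal_gen c `<=` ideal_mul m (ideal_gen l) ->
    GRing.lreg f -> regular_mod (ideal_gen c) f ->
    minimal_free_resolution m F
      (ideal_add_scale (ideal_gen c) f (ideal_gen l)) ->
    homogeneous_complex H e ->
  has_strict_cdga_structure F.
Proof.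
move=> [regc _] [regl l1] hc hl hf cl regf regcf minF he.
have gen_rev s : ideal_gen (rev s) = ideal_gen s.
  exact/eq_ideal_gen/mem_rev.
have /choice[dg hdg] x : exists z, (exists z, hpart H z x) -> hpart H z x.
  have [[z hz]|nz] := pselect (exists z, hpart H z x); first by exists z.
  by exists 0.
have ml x : x \in l -> m x.
  move=> xl; have [z hz] := hl x xl; have [//|[y xy]] := hpart_unit hz.
  case: l1; rewrite -xy mulrC -[_ * _]addr0.
  case: (ideal_ideal_gen l) => l0 lD; apply: lD => //; exact: mem_ideal_gen.
have hrl : graded_seq H dg (rev l) by move=> x; rewrite mem_rev => /hl/hdg.
(* If f is a unit then C + fL = fL, so that C may be replaced by 0. *)
wlog mf : c regc hc cl regcf minF / m f \/ c = [::].
  move=> wlogP; have [mf|[y fy]] := hpart_unit hf.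
    by apply: (wlogP c) => //; left.
  apply: (wlogP [::]) => //; last by right.
  - move=> x [u ->]; rewrite big_ord0.
    by exists 0%N, (fun=> 0), (fun=> 0); rewrite big_ord0; split=> // -[].
  - move=> x [u]; rewrite big_ord0 -(mulr0 f) => /regf ->.
    by exists u; rewrite big_ord0.
  suff <- : ideal_add_scale (ideal_gen c) f (ideal_gen l) =
    ideal_add_scale (ideal_gen [::]) f (ideal_gen l) by [].
  have [l0 lD] := ideal_ideal_gen l.
  apply/seteqP; split=> _ [u [v [gu gv ->]]]; last first.
    exists u, v; split=> //; case: gu => w ->; rewrite big_ord0.
    by case: (ideal_ideal_gen c).
  (* With [f * y = 1], one has [u + f * v = f * (y * u + v)], and [u] lies in L since C does. *)
  exists 0, (y * u + v); split.
  - by case: (ideal_ideal_gen ([::] : seq R)).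
  - apply: (lD) => //; have [n [a [b [_ lb ->]]]] := cl _ gu.
    apply: big_ind => // [x x' lx lx'|i _].
      by rewrite -[x]mul1r; apply: (lD).
    by rewrite -[_ * _]addr0; apply: lD.
  - by rewrite add0r mulrDr mulrA fy mul1r.
(* These images of the generators of K(c) define phi; elements outside [rev c] get the default 0. *)
have /choice[z hz] x : exists y : koszul (rev l), x \in rev c ->
    [/\ deg 1 y, coef_m m y, hom H dg (dg x) y & df y = x *: one _].
  have [xc|xc] := boolP (x \in rev c); last by exists 0.
  have hx : hpart H (dg x) x by apply/hdg/hc; rewrite -mem_rev.
  have [|y yP] := @koszul_lift_mul dg (rev l) x (dg x) hrl.
    by rewrite gen_rev; apply/cl/mem_ideal_gen; rewrite -mem_rev.
  by exists y => _; move: yP; rewrite pr_id.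
apply: (@minimal_resolution_cdga R m H dg f (rev c) (rev l) z _ _ _ _ _ _ _
  _ _ _ _ _ F e) => //.
- by apply: hdg; exists zf.
- by move=> x; rewrite mem_rev => /hc/hdg.
- move=> x; rewrite mem_rev => /mem_ideal_gen/cl[n [a [b [ma _ ->]]]].
  apply: big_ind => [|u v|i _]; [exact: (m0 H)|exact: (mD H)|].
  exact: (mMl H).
- by move=> x; rewrite mem_rev; apply: ml.
- by case: mf => [|->]; [left | right].
- apply: koszul_acyclic_cons; first exact: koszul_acyclic.
  by rewrite gen_rev.
- exact: koszul_acyclic.
- by move=> x /hz[].
- by move=> x /hz[].
- by move=> x /hz[].
- by rewrite !gen_rev.
Qed.

End CompleteIntersections.

(** * Local and graded rings *)

Section Local.
Variables (R : comNzRingType) (m : set R).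

Lemma subset_maximal_ideal (I : set R) : ideal I -> ~ I 1 ->
  exists2 n, maximal_ideal n & I `<=` n.
Proof.
move=> iI I1.
(* The empty set is only there to bound the empty chain. *)
pose P A := A = set0 \/ [/\ ideal A, ~ A 1 & I `<=` A].
have chainP (C : set (set R)) : C `<=` P -> total_on C subset ->
    P (\bigcup_(A in C) A).
  move=> CP tC.
  have [[A CA [a Aa]]|C0] := pselect (exists2 A, C A & A !=set0); last first.
    left; apply/seteqP; split=> // x [A CA Ax].
    by case: C0; exists A => //; exists x.
  have CP' B x : C B -> B x -> [/\ ideal B, ~ B 1 & I `<=` B].
    by move=> CB Bx; case: (CP B CB) => // B0; move: Bx; rewrite B0.
  right; split.
  - split; first by exists A => //; have [[A0 _] _ _] := CP' _ _ CA Aa.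
    move=> r u v [B CB Bu] [D CD Dv].
    have [BD|DB] := tC _ _ CB CD.
      exists D => //; have [[_ iD] _ _] := CP' _ _ CD Dv.
      by apply: iD => //; apply: BD.
    exists B => //; have [[_ iB] _ _] := CP' _ _ CB Bu.
    by apply: iB => //; apply: DB.
  - by move=> [B CB B1]; have [_] := CP' _ _ CB B1.
  - by move=> x Ix; exists A => //; have [_ _] := CP' _ _ CA Aa; apply.
have [A [PA maxA]] := Zorn_bigcup chainP.
case: PA => [A0|[iA A1 IA]].
  suff /maxA : A `<` I by case; right; split=> // x.
  by rewrite A0; split=> // /(_ 0); case: iI => I0 _ /(_ I0).
exists A => //; split=> // J iJ AJ J1; apply: contrapT => JA.
suff /maxA : A `<` J.
  by case; right; split=> //; apply: subset_trans AJ.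
by split=> // J'; apply: JA; apply/seteqP.
Qed.

Lemma local_unit x : local_ring m -> ~ m x -> exists y, x * y = 1.
Proof.
move=> [_ uniq_m] mx; apply: contrapT => nx.
pose I : set R := [set z | exists y, z = x * y].
have iI : ideal I.
  split; first by exists 0; rewrite mulr0.
  move=> a _ _ [u ->] [v ->]; exists (a * u + v).
  by rewrite mulrDr mulrCA.
have [|n maxn In] := @subset_maximal_ideal I iI.
  by move=> [y y1]; apply: nx; exists y.
by apply: mx; rewrite -(uniq_m _ maxn); apply: In; exists 1; rewrite mulr1.
Qed.

Definition local_setting (locR : local_ring m) : homog_setting m.
Proof.
apply: (@HomogSetting R m (fun=> setT) (fun=> id)) => //.
- by case: locR => -[].
- by case: locR => -[].
- move=> _ x _.
  by have [mx|/(local_unit locR)] := pselect (m x); [left | right].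
Defined.

End Local.

Section GradedSetting.
Variables (k : fieldType) (R : comAlgType k) (G : nat -> set R).
Hypothesis stdG : standard_graded G.

Lemma G0 n : G n 0.
Proof. by case: (sg_subspace stdG n). Qed.

Lemma G1 : G 0%N 1.
Proof. by apply/(sg_zero stdG); exists 1; rewrite scale1r. Qed.

Lemma GD n x y : G n x -> G n y -> G n (x + y).
Proof.
move=> Gx Gy; rewrite -[x]scale1r.
by case: (sg_subspace stdG n) => _; apply.
Qed.

Lemma GB n x y : G n x -> G n y -> G n (x - y).
Proof.
move=> Gx Gy; rewrite addrC -scaleN1r.
by case: (sg_subspace stdG n) => _; apply.
Qed.

(** The sum is required for all large [N], so that two decompositions can be compared at a common
    length. *)
Definition decomposition (c : nat -> R) (x : R) : Prop :=
  (forall i, G i (c i)) /\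
  exists n, forall N, (n <= N)%N -> x = \sum_(i < N) c i.

Lemma decomposition_ex x : exists c, decomposition c x.
Proof.
have [n [c [Gc ->]]] := sg_span stdG x.
exists (fun i => if (i < n)%N then c i else 0); split=> [i|].
  by case: ifP => _; [apply: Gc | apply: G0].
exists n => N /subnKC <-; rewrite big_split_ord /= [X in _ = _ + X]big1 ?addr0.
  by apply: eq_bigr => i _; rewrite ltn_ord.
by move=> i _; rewrite ltnNge leq_addr.
Qed.

Lemma decomposition_unique c d x i :
  decomposition c x -> decomposition d x -> c i = d i.
Proof.
move=> [Gc [n cx]] [Gd [n' dx]]; apply/eqP; rewrite -subr_eq0; apply/eqP.
pose N := maxn (maxn n n') i.+1.
apply: (@sg_direct _ _ _ stdG N (fun i => c i - d i)).
- by move=> j; apply: GB.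
- rewrite sumrB -cx -?dx ?subrr // /N.
    by rewrite leq_max leq_max leqnn orbT.
  by rewrite leq_max leq_max leqnn.
- by rewrite leq_max leqnn orbT.
Qed.

Definition component n x : R := sval (cid (decomposition_ex x)) n.

Lemma component_decomposition c x n : decomposition c x -> component n x = c n.
Proof.
move=> cx; apply: decomposition_unique cx.
exact: (svalP (cid (decomposition_ex x))).
Qed.

Lemma decomposition_component x : decomposition (component^~ x) x.
Proof. exact: (svalP (cid (decomposition_ex x))). Qed.

Lemma component_id n w x :
  G w x -> component n x = if n == w then x else 0.
Proof.
move=> Gx.
rewrite (@component_decomposition (fun n => if n == w then x else 0)) //.
split=> [i|]; first by case: eqP => [->|_] //; apply: G0.
exists w.+1 => N wN; rewrite (bigD1 (Ordinal wN)) //= eqxx big1 ?addr0 //.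
by move=> i /negPf iw; case: eqP => // ie; rewrite -val_eqE /= ie eqxx in iw.
Qed.

Lemma component0 n : component n 0 = 0.
Proof. by rewrite (component_id _ (G0 0%N)); case: ifP. Qed.

Lemma componentD n x y : component n (x + y) = component n x + component n y.
Proof.
apply: (@component_decomposition (fun n => component n x + component n y)).
have [Gx [p xE]] := decomposition_component x.
have [Gy [q yE]] := decomposition_component y.
split=> [i|]; first exact: GD.
exists (maxn p q) => N; rewrite geq_max => /andP[pN qN].
by rewrite big_split /= -xE // -yE.
Qed.

Lemma componentM n w x y : G w y ->
  component n (x * y) = if (w <= n)%N then component (n - w) x * y else 0.
Proof.
move=> Gy; apply: (@component_decomposition
  (fun n => if (w <= n)%N then component (n - w) x * y else 0)).
have [Gx [p xE]] := decomposition_component x.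
split=> [i|].
  case: ifP => [wi|_]; last exact: G0.
  by have := sg_mul stdG (Gx (i - w)%N) Gy; rewrite subnK.
exists (w + p)%N => N wpN.
have wN : (w <= N)%N by apply: leq_trans wpN; apply: leq_addr.
rewrite -(subnKC wN) big_split_ord /= big1 ?add0r.
  rewrite {1}(xE (N - w)%N) ?mulr_suml; last by rewrite leq_subRL.
  by apply: eq_bigr => i _; rewrite leq_addr addKn.
by move=> i _; rewrite leqNgt ltn_ord.
Qed.

Lemma irrelevant_idealE x : irrelevant_ideal G x <-> component 0 x = 0.
Proof.
split=> [[n [c [Gc ->]]]|x0].
  elim: n => [|n IH].
    by rewrite big_ord0 component0.
  by rewrite big_ord_recr /= componentD IH (component_id _ (Gc n)) addr0.
have [Gx [n xE]] := decomposition_component x.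
exists n, (fun i => component i.+1 x); split=> [i|]; first exact: Gx.
by rewrite {1}(xE n.+1) // big_ord_recl x0 add0r.
Qed.

Definition componentZ (z : int) x : R :=
  if z is Posz n then component n x else 0.

Lemma gradeZ0 z : gradeZ G z 0.
Proof. by case: z => // n; apply: G0. Qed.

Lemma componentZM z w x y :
  gradeZ G w y -> componentZ (z + w) (x * y) = componentZ z x * y.
Proof.
case: w => [w|w] /=; last first.
  move=> ->; rewrite !mulr0 /componentZ.
  by case: (z + _) => // n; apply: component0.
move=> Gy; case: z => [z|z].
  by rewrite -PoszD /= (componentM _ _ Gy) leq_addl addnK.
(* Here [z] is negative, so [t < w] and the product with [y] has no component of degree [t]. *)
rewrite /= mul0r; case zw: (_ + _) => [t|//] /=.
rewrite (componentM _ _ Gy) ifF //; apply/negbTE; rewrite -ltnNge.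
by rewrite -ltz_nat -zw NegzE Num.Theory.gtrDr Num.Theory.oppr_lt0.
Qed.

Definition graded_setting : homog_setting (irrelevant_ideal G).
Proof.
apply: (@HomogSetting R _ (gradeZ G) componentZ).
- split; first by apply/irrelevant_idealE; apply: component0.
  move=> a u v [n [c [Gc ->]]] /irrelevant_idealE v0; apply/irrelevant_idealE.
  rewrite componentD v0 addr0 mulr_sumr.
  apply: (big_ind (fun x => component 0 x = 0)) => [|x y|i _].
    - exact: component0.
    - by rewrite componentD => -> ->; rewrite addr0.
  - by rewrite (componentM _ _ (Gc i)).
- rewrite irrelevant_idealE (component_id _ G1) /=.
  by apply/eqP; apply: oner_neq0.
- move=> z w x y; case: z => [z|z] /=; last first.
    by move=> -> _; rewrite mul0r; apply: gradeZ0.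
  case: w => [w|w] /=; last by move=> _ ->; rewrite mulr0; apply: gradeZ0.
  exact: (sg_mul stdG).
- exact: G1.
- by move=> [z|z] x y /=; rewrite ?addr0 // componentD.
- exact: componentZM.
- by move=> [z|z] x //=; have [] := decomposition_component x.
- move=> [z|z] x /=; last by move=> ->.
  by move=> /component_id->; rewrite eqxx.
- move=> [z|z] x /irrelevant_idealE x0; apply/irrelevant_idealE;
    last exact: component0.
  have [Gx _] := decomposition_component x.
  by rewrite (component_id _ (Gx z)); case: eqP => // <-.
- move=> [[|z]|z] x /=.
  (* Degree 0 consists of scalars from the field, each zero or a unit; in positive degree an element
     lies in the irrelevant ideal. *)
  + move=> /(sg_zero stdG)[a ->]; have [->|a0] := eqVneq a 0.
      by left; rewrite scale0r; apply/irrelevant_idealE; apply: component0.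
    right; exists (a^-1%:A); rewrite -scalerAl mul1r scalerA mulfV //.
    exact: scale1r.
  + by move=> Gx; left; apply/irrelevant_idealE; rewrite (component_id _ Gx).
  + by move=> ->; left; apply/irrelevant_idealE; apply: component0.
Defined.

End GradedSetting.

Theorem corollary4p1 :
  (forall (R : comNzRingType) (m C L : set R) (f : R),
     noetherian R -> local_ring m ->
     complete_intersection C -> complete_intersection L ->
     C `<=` ideal_mul m L ->
     GRing.lreg f -> regular_mod C f ->
     forall F : free_complex R,
       minimal_free_resolution m F (ideal_add_scale C f L) ->
       has_strict_cdga_structure F)
  /\
  (forall (k : fieldType) (R : comAlgType k) (G : nat -> set R)
          (C L : set R) (f : R),
     standard_graded G ->
     homogeneous_complete_intersection G C ->
     homogeneous_complete_intersection G L ->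
     homogeneous G f ->
     C `<=` ideal_mul (irrelevant_ideal G) L ->
     GRing.lreg f -> regular_mod C f ->
     forall F : free_complex R,
       minimal_graded_free_resolution G F (ideal_add_scale C f L) ->
       has_strict_cdga_structure F).
Proof.
split=> [R m C L f _ locR|k R G C L f stdG].
  move=> [c [regc ->]] [l [regl ->]] cl regf regcf F minF.
  (* In the local setting every element is homogeneous of every degree, so all degrees may be taken
     to be 0. *)
  apply: (@complete_intersection_cdga R m (local_setting locR) c l f 0 F
    (fun _ _ => 0)) => //; by move=> x _; exists 0.
move=> [c [regc hc ->]] [l [regl hl ->]] [d fd] cl regf regcf F [minF [e he]].
apply: (@complete_intersection_cdga R _ (graded_setting stdG)
  c l f d F e) => //.
- by move=> x /hc[n xn]; exists n%:Z.
- by move=> x /hl[n xn]; exists n%:Z.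
Qed.
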